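(* Let $n>m>1$, and let $\mathcal{K}=\mathcal{K}(\mathbb{X}_{m,n})=\mathbb{C}(u)$, $u=(u_{i,j})_{1\le i\le m-1,\ m+2\le j\le n}$, with the points $p_1,\dots,p_n$, the homogeneous coordinates $x=(x_1,\dots,x_m)$, the group $W_{m,n}$ acting on $\mathcal{K}(\mathbb{X}_{m,n+1})=\mathbb{C}(u,z)$, the lattice $L_{m,n}$, the orbit $M_{m,n}$ and the spaces $L(\Lambda)$ as described in the context. (1) For every $\Lambda\in M_{m,n}$ one has $\dim_{\mathcal{K}}L(\Lambda)=1$. (2) Let $w\in W_{m,n}$ and choose nonzero polynomials $F_i(x)\in L(w.e_i)$ and $G_i(x)\in L(ws_0.e_i)$ for $i=1,\dots,m$. Then $$(w(z_1):\dots:w(z_{m-1}):1)=\Big(c_1\frac{G_1(x)}{F_1(x)}:\dots:c_m\frac{G_m(x)}{F_m(x)}\Big)$$ for some nonzero constants $c_1,\dots,c_m\in\mathcal{K}$.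
   Context: An $n$-tuple $(p_1,\dots,p_n)$ of points of $\mathbb{P}^{m-1}(\mathbb{C})$ is in general position if the points are distinct and every hyperplane contains fewer than $m$ of them. $\mathbb{X}_{m,n}$ is the space of such $n$-tuples modulo the diagonal $PGL_m(\mathbb{C})$-action; the class is written $[p_1,\dots,p_n]$. Every class has a unique representative with $p_1=(1:0:\dots:0),\dots,p_m=(0:\dots:0:1)$, $p_{m+1}=(1:\dots:1)$, $p_j=(u_{1,j}:\dots:u_{m-1,j}:1)$ for $m+2\le j\le n$; this identifies $\mathbb{X}_{m,n}$ with a Zariski open subset of $\mathbb{C}^{(m-1)(n-m-1)}$ with coordinates $u_{i,j}$, and $\mathcal{K}(\mathbb{X}_{m,n})=\mathbb{C}(u)$. Similarly $\mathbb{X}_{m,n+1}$ has coordinates $(u,z)$ with $z=(z_1,\dots,z_{m-1})$ and $p_{n+1}=q=(z_1:\dots:z_{m-1}:1)$. The Weyl group $W_{m,n}$ is the Coxeter group generated by $s_0,\dots,s_{n-1}$ with $s_i^2=1$, $s_is_j=s_js_i$ if nodes $i,j$ are not joined and $s_is_js_i=s_js_is_j$ if they are joined in the tree $T_{2,m,n-m}$ (nodes $1-2-\dots-(n-1)$ form a chain and node $0$ is joined to node $m$). It acts birationally on the right on $\mathbb{X}_{m,n}$: $s_k$ ($1\le k\le n-1$) swaps $p_k,p_{k+1}$, and $[p_1,\dots,p_n].s_0=[p_1,\dots,p_m,\tilde p_{m+1},\dots,\tilde p_n]$ where, in coordinates in which $p_1,\dots,p_m$ are the coordinate points, $\tilde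 p=(x_1^{-1}:\dots:x_m^{-1})$ for $p=(x_1:\dots:x_m)$ (standard Cremona transformation). This induces a left action on rational functions: $w(\varphi)([P])=\varphi([P].w)$. The same construction gives $W_{m,n+1}$ acting on $\mathbb{X}_{m,n+1}$; restricting to $W_{m,n}=\langle s_0,\dots,s_{n-1}\rangle\subset W_{m,n+1}$ gives automorphisms of $\mathbb{C}(u,z)$, and $w(z_i)$ refers to this action. $L_{m,n}=\bigoplus_{j=0}^n\mathbb{Z}e_j$ with symmetric form $\langle e_0,e_0\rangle=-(m-2)$, $\langle e_j,e_j\rangle=1$ ($1\le j\le n$), $\langle e_i,e_j\rangle=0$ ($i\ne j$); $h_0=e_0-e_1-\dots-e_m$, $h_k=e_k-e_{k+1}$; $W_{m,n}$ acts on $L_{m,n}$ by $s_k.\Lambda=\Lambda-\langle h_k,\Lambda\rangle h_k$. $M_{m,n}=W_{m,n}\{e_1,\dots,e_n\}$. Fix nonzero $a_1,\dots,a_m\in\mathcal{K}$ and homogeneous coordinates $x=(x_1,\dots,x_m)$ on $\mathbb{P}^{m-1}(\mathcal{K})$ with $(z_1:\dots:z_{m-1}:1)=(a_1x_1:\dots:a_mx_m)$; the points $p_j$ (with coordinates in $\mathcal{K}$) are expressed in these coordinates. For $\Lambda=de_0-\nu_1e_1-\dots-\nu_ne_n\in L_{m,n}$, $L(\Lambda)$ is the $\mathcal{K}$-vector space of homogeneous polynomials $f\in\mathcal{K}[x]$ of degree $d$ with $\mathrm{ord}_{p_j}f\ge\nu_j$ for $j=1,\dots,n$. *)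

(* Defs.v *)
From HB Require Import structures.
From mathcomp Require Import all_boot all_algebra.
From mathcomp Require Import Rstruct.
From mathcomp Require Import complex.
From mathcomp Require Import mpoly.

Set Implicit Arguments.
Unset Strict Implicit.
Unset Printing Implicit Defensive.

Import GRing.Theory.
Local Open Scope ring_scope.

Definition CC : fieldType := Rdefinitions.R[i].

(* For a configuration space X_{m,N} (N points of P^{m-1}), the coordinates  *)
(* are u_{i,j} with 0 <= i < m-1 and 0 <= j < N-m-1 (0-based; column j       *)
(* corresponds to the (m+2+j)-th point, 1-based).  The variable u_{i,j} is   *)
(* the mpoly variable number  i + (m-1)*j.                                   *)
Definition nvars (m N : nat) : nat := (m.-1 * (N - m.+1))%N.

Definition cfield (m N : nat) : fieldType := {fraction {mpoly CC[nvars m N]}}.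

Definition coordvar (m N : nat) (i j : nat) : cfield m N :=
  if (i < m.-1)%N && (j < N - m.+1)%N then
    match (insub (i + m.-1 * j)%N : option 'I_(nvars m N)) with
    | Some v => FracField.tofrac ('X_v)
    | None => 0
    end
  else 0.

Definition cst (k : nat) (c : CC) : {fraction {mpoly CC[k]}} := FracField.tofrac (c%:MP).

Definition frac_eval (k : nat) (F : fieldType) (f : CC -> F) (h : 'I_k -> F)
    (phi : {fraction {mpoly CC[k]}}) : F :=
  let q := repr phi in mmap f h (\n_q) / mmap f h (\d_q).

(* Configurations of points in P^r (r = m-1), given by representatives      *)
(* P j : 'cV_(r+1) of the j-th point (0-based index j).                      *)

(* coordinates (0-based point j, 0-based coordinate i) of the standard
   representative: p_1..p_m coordinate points, p_{m+1} = (1:...:1),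
   p_{m+2+j} = (u_{0,j} : ... : u_{m-2,j} : 1). *)
Definition stdcoord (r : nat) (F : nzRingType) (crd : nat -> nat -> F)
    (j i : nat) : F :=
  if (j < r.+1)%N then (i == j)%:R
  else if j == r.+1 then 1
  else if (i < r)%N then crd i (j - r.+2)%N else 1.

Definition stdpts (r : nat) (F : nzRingType) (crd : nat -> nat -> F)
    (j : nat) : 'cV[F]_r.+1 :=
  \col_(i < r.+1) stdcoord r crd j i.

(* normalized coordinates of the class of the configuration P:
   the projective transformation g sends p_1..p_{r+1} to the coordinate
   points and p_{r+2} to (1:...:1); then coordinate i of the (r+3+j)-th
   point is divided by its last coordinate. *)
Definition normalize (r : nat) (F : fieldType) (P : nat -> 'cV[F]_r.+1) :
    nat -> nat -> F :=
  let A : 'M[F]_r.+1 := \matrix_(i, k) P k i 0 in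
  let v := invmx A *m P r.+1 in
  let g := invmx (A *m diag_mx v^T) in
  fun i j => let y := g *m P (r.+2 + j)%N in y (inord i) 0 / y ord_max 0.

(* The generators s_k of W acting on (standard representatives of)
   configurations: s_0 = standard Cremona transformation on p_{m+1},...,
   s_k (k >= 1) swaps p_k and p_{k+1} (1-based). *)
Definition gen_pts (r : nat) (F : fieldType) (k : nat)
    (P : nat -> 'cV[F]_r.+1) : nat -> 'cV[F]_r.+1 :=
  if k == 0%N then fun j => if (j < r.+1)%N then P j else \col_i (P j i 0)^-1
  else fun j => P (if j == k.-1 then k else if j == k then k.-1 else j).

(* left action of the generator s_k on rational functions on X_{m,N}:
   s_k(phi)([P]) = phi([P].s_k). *)
Definition gen_act (m N k : nat) (phi : cfield m N) : cfield m N :=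
  let crd' := normalize (gen_pts k (stdpts m.-1 (@coordvar m N))) in
  frac_eval (@cst (nvars m N))
    (fun v : 'I_(nvars m N) => crd' (v %% m.-1)%N (v %/ m.-1)%N) phi.

(* action of the element w = s_{k1} s_{k2} ... s_{kr}, given as the word
   [:: k1; ...; kr] : w(phi) = s_{k1}( s_{k2}( ... s_{kr}(phi))). *)
Definition word_act (m N : nat) (w : seq nat) (phi : cfield m N) : cfield m N :=
  foldr (@gen_act m N) phi w.

Definition lat (n : nat) := {ffun 'I_n.+1 -> int}.

Definition lat_e (n j : nat) : lat n := [ffun i : 'I_n.+1 => ((i : nat) == j)%:R].

Definition lat_form (m n : nat) (a b : lat n) : int :=
  (2 - m%:Z) * a ord0 * b ord0 + \sum_(j < n.+1 | (0 < j)%N) a j * b j.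

Definition lat_h (m n k : nat) : lat n :=
  if k == 0%N then [ffun i : 'I_n.+1 => lat_e n 0 i - \sum_(1 <= l < m.+1) lat_e n l i]
  else [ffun i => lat_e n k i - lat_e n k.+1 i].

Definition lat_refl (m n k : nat) (L : lat n) : lat n :=
  [ffun i => L i - lat_form m (lat_h m n k) L * lat_h m n k i].

Definition lat_act (m n : nat) (w : seq nat) (L : lat n) : lat n :=
  foldr (@lat_refl m n) L w.

Definition is_word (n : nat) (w : seq nat) : bool := all (fun k => (k < n)%N) w.

Definition in_M (m n : nat) (L : lat n) : Prop :=
  exists w, is_word n w /\ exists j, (1 <= j <= n)%N /\ L = @lat_act m n w (lat_e n j).

Definition ord_ge (k : nat) (F : idomainType) (f : {mpoly F[k]}) (p : 'I_k -> F)
    (nu : int) : Prop :=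
  forall mo : 'X_{1..k}, ((mdeg mo)%:Z < nu)%R ->
    (f \mPo [tuple ('X_i + (p i)%:MP) | i < k])@_mo = 0.

Definition homog_of_deg (k : nat) (F : idomainType) (d : int) (f : {mpoly F[k]}) : Prop :=
  if (0 <= d)%R then f \is (absz d).-homog else f == 0.

(* x-coordinates of the point p_{j+1} (0-based j), where the standard
   coordinates y satisfy y_i = a_i x_i *)
Definition xpt (m n : nat) (a : 'I_m -> cfield m n) (j : nat) : 'I_m -> cfield m n :=
  fun i => stdcoord m.-1 (@coordvar m n) j i / a i.

(* f in L(Lambda),  Lambda = d e_0 - nu_1 e_1 - ... - nu_n e_n *)
Definition inL (m n : nat) (a : 'I_m -> cfield m n) (L : lat n)
    (f : {mpoly (cfield m n)[m]}) : Prop :=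
  homog_of_deg (L ord0) f /\
  forall j : 'I_n, ord_ge f (xpt a j) (- L (lift ord0 j)).

Definition dimL_eq1 (m n : nat) (a : 'I_m -> cfield m n) (L : lat n) : Prop :=
  exists2 f, inL a L f /\ f != 0 &
    forall g, inL a L g -> exists c : cfield m n, g = c *: f.

Definition embK (m n : nat) (c : cfield m n) : cfield m n.+1 :=
  frac_eval (@cst (nvars m n.+1))
    (fun v : 'I_(nvars m n) => coordvar m n.+1 (v %% m.-1)%N (v %/ m.-1)%N) c.

(* z_i (0-based i < m-1): coordinates of p_{n+1} = q *)
Definition zvar (m n i : nat) : cfield m n.+1 := coordvar m n.+1 i (n - m).-1.

(* value of a (homogeneous) polynomial in x at x = (z_1/a_1,...,z_{m-1}/a_{m-1},1/a_m),
   a representative of the point q with (z:1) = (a_1 x_1 : ... : a_m x_m) *)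
Definition at_q (m n : nat) (a : 'I_m -> cfield m n) (f : {mpoly (cfield m n)[m]}) :
    cfield m n.+1 :=
  mmap (@embK m n)
    (fun i : 'I_m => (if (i < m.-1)%N then zvar m n i else 1) / embK (a i)) f.

(* Main.v *)
Require Import Defs.
From HB Require Import structures.
From mathcomp Require Import fingroup perm all_boot all_order all_algebra.
From mathcomp Require Import Rstruct complex mpoly.
From mathcomp Require Import ring zify.

(* Normalizing a configuration after applying a generator s_k changes it only by a linear map
   (frame_mx) and a rescaling of the representatives, so L(s_k.Lambda) is obtained from
   L(Lambda) by letting s_k act on the coefficients, changing coordinates linearly and, for
   k = 0, pulling back along the standard Cremona transformation.  Each of these operations is
   invertible, which propagates dim L = 1 from the constants L(e_j).
   Evaluating at the generic point q, the same operation multiplies f(q) by a factor that is a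
   character of the lattice element.  As w s_0.e_i - w.e_i = w.h_0 does not depend on i, the
   ratios G_i(q)/F_i(q) acquire a common factor, and the formula for w(z_i) follows by
   induction on w from G_i/F_i = x_i for w = 1. *)

Set Implicit Arguments.
Unset Strict Implicit.
Unset Printing Implicit Defensive.

Import Order.TTheory GRing.Theory Num.Theory.
Local Open Scope ring_scope.

(** * Specialization of rational functions *)

(** The obstacle is that a generator is given by substitution into a chosen numerator and
    denominator, so it is a ring morphism only once no nonzero polynomial is sent to 0. In the
    affine coordinates the substitution is explicit and squares to the identity, and this gives
    injectivity: substituting a second time returns the polynomial itself. The coefficients have to
    be acted on because the points p_j are themselves functions of u: s_k turns them into the
    standard representative of [P].s_k, and the frame matrix maps that one to the swapped or
    Cremona-transformed points. The factor at q is a character because it is a product of powers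
    with exponents d (rescaling of q) and d - nu_i (Cremona monomial), which are linear in Lambda.
    Dimension one serves a second time in part (2): the given F_i and G_i are scalar multiples of
    the ones built along w, and the quotients of these scalars are the c_i. The a_i enter only at
    the end, through one diagonal substitution. *)

Lemma cst_zmod_morphism k : zmod_morphism (@cst k).
Proof. by move=> x y; rewrite /cst mpolyCB tofracB. Qed.

Lemma cst_monoid_morphism k : monoid_morphism (@cst k).
Proof. by split=> [|x y]; rewrite /cst ?mpolyCM ?tofracM ?tofrac1. Qed.

HB.instance Definition _ k :=
  GRing.isZmodMorphism.Build CC {fraction {mpoly CC[k]}} (@cst k) (@cst_zmod_morphism k).
HB.instance Definition _ k :=
  GRing.isMonoidMorphism.Build CC {fraction {mpoly CC[k]}} (@cst k) (@cst_monoid_morphism k).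

Lemma rmorph_mmap (k : nat) (R : nzRingType) (S T : comNzRingType) (f : {rmorphism R -> S})
    (g : {rmorphism S -> T}) (h : 'I_k -> S) (p : {mpoly R[k]}) :
  g (mmap f h p) = mmap (g \o f) (g \o h) p.
Proof.
rewrite /mmap rmorph_sum; apply: eq_bigr => m _ /=.
rewrite rmorphM /mmap1 rmorph_prod; congr (_ * _).
by apply: eq_bigr => i _ /=; rewrite rmorphXn.
Qed.

Lemma eq_mmap (k : nat) (R S : nzRingType) (f g : R -> S) (h h' : 'I_k -> S)
    (p : {mpoly R[k]}) : f =1 g -> h =1 h' -> mmap f h p = mmap g h' p.
Proof.
move=> efg eh; rewrite /mmap; apply: eq_bigr => m _.
by rewrite efg; congr (_ * _); apply: mmap1_eq.
Qed.

Lemma mmap_cst_vars (k : nat) (p : {mpoly CC[k]}) :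
  mmap (@cst k) (fun v => FracField.tofrac 'X_v) p = FracField.tofrac p.
Proof.
rewrite -{2}[p]comp_mpoly_id /comp_mpoly rmorph_mmap.
by apply: eq_mmap => // v /=; rewrite tnth_mktuple.
Qed.

(** [frac_eval] reads numerator and denominator off the representative chosen by [repr]; knowing
    that the fraction is their quotient allows this choice to be forgotten. *)
Lemma frac_numden (R : idomainType) (x : {fraction R}) :
  x = FracField.tofrac (frac (repr x)).1 / FracField.tofrac (frac (repr x)).2.
Proof.
have d0 := denom_ratioP (repr x).
apply: (mulIf (_ : FracField.tofrac (frac (repr x)).2 != 0)); first by rewrite tofrac_eq0.
rewrite divfK ?tofrac_eq0 //.
rewrite -{1}[x]reprK; move: (repr x) d0 => y d0.
transitivity (FracField.mul (\pi_({fraction R}) y)%qT (FracField.tofrac y.2)) => //.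
rewrite [FracField.tofrac y.2]piE [FracField.tofrac y.1]piE.
rewrite -FracField.pi_mul; apply/eqmodP.
rewrite /= FracField.equivfE /FracField.mulf /= !numden_Ratio ?mulr1 ?oner_neq0 //.
by rewrite mulrC.
Qed.

Section FracEval.
Variables (k : nat) (F : fieldType) (f : {rmorphism CC -> F}) (h : 'I_k -> F).
Hypothesis mmap_inj0 : forall p : {mpoly CC[k]}, p != 0 -> mmap f h p != 0.

(** Two representations of one fraction satisfy a cross-multiplied polynomial identity, which
    survives the substitution; the denominators stay nonzero by [mmap_inj0]. *)
Lemma frac_eval_frac (p q : {mpoly CC[k]}) : q != 0 ->
  frac_eval f h (FracField.tofrac p / FracField.tofrac q) = mmap f h p / mmap f h q.
Proof.
move=> q0; rewrite /frac_eval; set x := FracField.tofrac p / _.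
have := frac_numden x; have := denom_ratioP (repr x).
move: (frac (repr x)).1 (frac (repr x)).2 => n d d0 /eqP.
rewrite /x eqr_div ?tofrac_eq0 // -!tofracM tofrac_eq => /eqP E.
apply/eqP; rewrite eqr_div ?mmap_inj0 // -!rmorphM /= E.
by rewrite mulrC.
Qed.

(** The injectivity proof is an argument so that the ring morphism structure, which depends on it,
    can be attached to the function. *)
Definition frac_hom of (forall p : {mpoly CC[k]}, p != 0 -> mmap f h p != 0) := frac_eval f h.

Lemma frac_hom_zmod : zmod_morphism (frac_hom mmap_inj0).
Proof.
move=> x y; rewrite (frac_numden x) (frac_numden y).
move: (denom_ratioP (repr x)) (denom_ratioP (repr y)).
move: (frac (repr x)).1 (frac (repr x)).2 (frac (repr y)).1 (frac (repr y)).2.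
move=> n d n' d' d0 d'0; rewrite /frac_hom -mulNr -tofracN addf_div ?tofrac_eq0 //.
rewrite -!tofracM -tofracD !frac_eval_frac ?mulf_neq0 //.
by rewrite -mulNr addf_div ?mmap_inj0 // rmorphD !rmorphM rmorphN.
Qed.

Lemma frac_hom_monoid : monoid_morphism (frac_hom mmap_inj0).
Proof.
split=> [|x y].
  have -> : 1 = FracField.tofrac 1 / FracField.tofrac 1 :> {fraction {mpoly CC[k]}}.
    by rewrite tofrac1 divr1.
  by rewrite /frac_hom frac_eval_frac ?oner_neq0 // divff // mmap_inj0 ?oner_neq0.
rewrite (frac_numden x) (frac_numden y).
move: (denom_ratioP (repr x)) (denom_ratioP (repr y)).
move: (frac (repr x)).1 (frac (repr x)).2 (frac (repr y)).1 (frac (repr y)).2.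
move=> n d n' d' d0 d'0; rewrite /frac_hom mulf_div -!tofracM !frac_eval_frac ?mulf_neq0 //.
by rewrite !rmorphM mulf_div.
Qed.

HB.instance Definition _ :=
  GRing.isZmodMorphism.Build {fraction {mpoly CC[k]}} F (frac_hom mmap_inj0) frac_hom_zmod.
HB.instance Definition _ :=
  GRing.isMonoidMorphism.Build {fraction {mpoly CC[k]}} F (frac_hom mmap_inj0)
    frac_hom_monoid.

Lemma frac_eval_tofrac (p : {mpoly CC[k]}) :
  frac_eval f h (FracField.tofrac p) = mmap f h p.
Proof.
rewrite -[FracField.tofrac p]divr1 -tofrac1 frac_eval_frac ?oner_neq0 //.
by rewrite rmorph1 divr1.
Qed.

End FracEval.

Lemma eq_frac_rmorph (k : nat) (F : fieldType) (s t : {rmorphism {fraction {mpoly CC[k]}} -> F}) :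
  (forall c, s (cst k c) = t (cst k c)) ->
  (forall v, s (FracField.tofrac 'X_v) = t (FracField.tofrac 'X_v)) -> s =1 t.
Proof.
move=> ec ev x; rewrite (frac_numden x) !fmorph_div.
by congr (_ / _); rewrite -mmap_cst_vars !rmorph_mmap; apply: eq_mmap => ? /=.
Qed.

(* [frac_rel ev x y]: the fraction [x] is defined under the specialization [ev], with value [y]. *)
Section FracRel.
Variables (R : idomainType) (K : fieldType) (ev : {rmorphism R -> K}).
Local Notation "p %:F" := (FracField.tofrac p).

Definition frac_rel (x : {fraction R}) (y : K) : Prop :=
  exists a b : R, [/\ ev b != 0, x * b%:F = a%:F & y * ev b = ev a].

Lemma frac_rel_fun x y y' : frac_rel x y -> frac_rel x y' -> y = y'.
Proof.
move=> [a [b [b0 xb yb]]] [a' [b' [b'0 xb' yb']]].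
have E : a * b' = a' * b.
  by apply/eqP; rewrite -tofrac_eq !tofracM -xb -xb' mulrAC.
apply: (mulIf b0); apply: (mulIf b'0).
by rewrite yb -rmorphM E rmorphM -yb' mulrAC.
Qed.

Lemma frac_rel_tofrac p : frac_rel p%:F (ev p).
Proof. by exists p, 1; rewrite rmorph1 tofrac1 oner_neq0 !mulr1. Qed.

Lemma frac_rel0 : frac_rel 0 0.
Proof. by have := frac_rel_tofrac 0; rewrite !rmorph0. Qed.

Lemma frac_rel1 : frac_rel 1 1.
Proof. by have := frac_rel_tofrac 1; rewrite !rmorph1. Qed.

Lemma frac_relD x y x' y' :
  frac_rel x y -> frac_rel x' y' -> frac_rel (x + x') (y + y').
Proof.
move=> [a [b [b0 xb yb]]] [a' [b' [b'0 xb' yb']]].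
exists (a * b' + a' * b), (b * b'); split; first by rewrite rmorphM mulf_neq0.
  by rewrite tofracD !tofracM -xb -xb' mulrDl mulrA [b%:F * _]mulrC mulrA.
by rewrite rmorphD !rmorphM -yb -yb' mulrDl mulrA [ev b * _]mulrC mulrA.
Qed.

Lemma frac_relM x y x' y' :
  frac_rel x y -> frac_rel x' y' -> frac_rel (x * x') (y * y').
Proof.
move=> [a [b [b0 xb yb]]] [a' [b' [b'0 xb' yb']]].
exists (a * a'), (b * b'); split; first by rewrite rmorphM mulf_neq0.
  by rewrite !tofracM -xb -xb' mulrACA.
by rewrite !rmorphM -yb -yb' mulrACA.
Qed.

Lemma frac_relN x y : frac_rel x y -> frac_rel (- x) (- y).
Proof.
by move=> [a [b [b0 xb yb]]]; exists (- a), b; rewrite tofracN rmorphN -xb -yb !mulNr.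
Qed.

Lemma frac_relV x y : frac_rel x y -> y != 0 -> frac_rel x^-1 y^-1.
Proof.
move=> [a [b [b0 xb yb]]] y0; have a0 : ev a != 0 by rewrite -yb mulf_neq0.
have x0 : x != 0.
  apply: contraNneq a0 => x0; move: xb; rewrite x0 mul0r => /esym/eqP.
  by rewrite tofrac_eq0 => /eqP ->; rewrite rmorph0.
by exists b, a; split; rewrite ?a0 -?xb -?yb ?mulKf.
Qed.

Lemma frac_relX x y e : frac_rel x y -> frac_rel (x ^+ e) (y ^+ e).
Proof.
move=> xy; elim: e => [|e IHe]; first exact: frac_rel1.
by rewrite !exprS; apply: frac_relM.
Qed.

End FracRel.

(** * Substitutions that square to the identity are field automorphisms *)

Section FracInvolution.
Variables (k : nat) (h : 'I_k -> {fraction {mpoly CC[k]}}).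
Local Notation ev := (mmap (@cst k) h).

Lemma frac_rel_mmap (g g' : 'I_k -> {fraction {mpoly CC[k]}}) (p : {mpoly CC[k]}) :
  (forall v, frac_rel ev (g v) (g' v)) ->
  frac_rel ev (mmap (@cst k) g p) (mmap (@cst k) g' p).
Proof.
move=> gg'; rewrite /mmap; elim/big_rec2: _ => [|m y1 y2 _ IH]; first exact: frac_rel0.
apply: frac_relD IH; apply: frac_relM.
  by have := frac_rel_tofrac ev (p@_m)%:MP; rewrite /= mmapC.
rewrite /mmap1; elim/big_rec2: _ => [|v z1 z2 _ IH]; first exact: frac_rel1.
by apply: frac_relM IH; apply: frac_relX.
Qed.

Hypothesis hK : forall v, frac_rel ev (h v) (FracField.tofrac 'X_v).

(** By [hK], the fraction [ev p] specializes under [ev] to [p] itself. If [ev p] were 0, uniqueness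
    of the specialized value would force [p] to be 0. *)
Lemma frac_rel_inj (p : {mpoly CC[k]}) : p != 0 -> ev p != 0.
Proof.
move=> p0; apply: contraNneq p0 => ep0.
have := frac_rel_mmap p hK; rewrite ep0 mmap_cst_vars => rel0p.
by rewrite -tofrac_eq0; apply/eqP/(frac_rel_fun rel0p)/frac_rel0.
Qed.

Lemma frac_rel_eval x y : frac_rel ev x y -> frac_eval (@cst k) h x = y.
Proof.
move=> [a [b [b0 xb yb]]]; have tb0 : b != 0.
  by apply: contraNneq b0 => ->; rewrite rmorph0.
have -> : x = FracField.tofrac a / FracField.tofrac b.
  by rewrite -xb mulfK ?tofrac_eq0.
rewrite frac_eval_frac; first by rewrite -[mmap _ _ a]yb mulfK.
- exact: frac_rel_inj.
- exact: tb0.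
Qed.

Lemma frac_eval_invol : involutive (frac_eval (@cst k) h).
Proof.
pose s : {rmorphism _ -> _} := frac_hom frac_rel_inj.
have sE : s =1 frac_eval (@cst k) h by [].
have sF p : s (FracField.tofrac p) = mmap (@cst k) h p.
  by rewrite sE (frac_eval_tofrac frac_rel_inj).
move=> x; rewrite -!sE; pose ss : {rmorphism _ -> _} := s \o s; 
pose i : {rmorphism {fraction {mpoly CC[k]}} -> {fraction {mpoly CC[k]}}} := idfun.
suff: ss =1 i by move=> /(_ x).
apply: eq_frac_rmorph => [c|v].
  by rewrite -[RHS]/(cst k c) -[LHS]/(s (s (cst k c))) [cst k c]/cst sF mmapC sF mmapC.
rewrite -[RHS]/(FracField.tofrac 'X_v) -[LHS]/(s (s (FracField.tofrac 'X_v))).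
by rewrite sF mmapX mmap1U sE; apply: frac_rel_eval.
Qed.

End FracInvolution.

(** * The generators in coordinates *)

Definition swapn (a b i : nat) : nat := if i == a then b else if i == b then a else i.

(* The generator [s_k] in the affine coordinates [u_(i, j)]. *)
Definition coord_act (r : nat) (F : fieldType) (k : nat) (u : nat -> nat -> F)
    (i j : nat) : F :=
  if k == 0%N then (u i j)^-1
  else if (k < r)%N then u (swapn k.-1 k i) j
  else if k == r then (if i == r.-1 then (u r.-1 j)^-1 else u i j / u r.-1 j)
  else if k == r.+1 then 1 - u i j
  else if k == r.+2 then (if j == 0%N then (u i 0%N)^-1 else u i j / u i 0%N)
  else u i (swapn (k - r.+3) (k - r.+2) j).

(* [frame_mx] and [frame_scale] bring the standard representative of [P].s_k back to the
   configuration [gen_pts k P]. *)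
Definition frame_mx (r : nat) (F : fieldType) (k : nat) (u : nat -> nat -> F) : 'M[F]_r.+1 :=
  if (0 < k <= r)%N then perm_mx (tperm (inord k.-1) (inord k))
  else if k == r.+1 then
    \matrix_(i, j) (if (j < r)%N then - (i == j)%:R else 1)
  else if k == r.+2 then diag_mx (\row_i (if (i < r)%N then u i 0%N else 1))
  else 1%:M.

Definition frame_scale (r : nat) (F : fieldType) (k : nat) (u : nat -> nat -> F)
    (l : nat) : F :=
  if (k < r)%N then 1
  else if k == r then (if (r.+1 < l)%N then u r.-1 (l - r.+2)%N else 1)
  else if k == r.+1 then (if (l < r)%N then -1 else 1)
  else if k == r.+2 then (if (l < r)%N then (u l 0%N)^-1 else 1)
  else 1.

Section Frame.
Variables (r : nat) (F : fieldType) (N k : nat) (u : nat -> nat -> F).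
Hypotheses (r0 : (0 < r)%N) (kN : (k < N)%N).
Hypothesis u0 : forall i j, (i < r)%N -> (j < N - r.+2)%N -> u i j != 0.

Lemma frame_scale_neq0 l : (l < N)%N -> frame_scale r k u l != 0.
Proof.
move=> lN; rewrite /frame_scale; repeat case: ifP => ?; rewrite ?invr_eq0 ?oppr_eq0 ?oner_eq0 //;
  apply: u0; lia.
Qed.

Lemma frame_mxE (p : nat) (v : 'M[F]_(r.+1, p)) i z :
  (frame_mx r k u *m v) i z =
  if (0 < k <= r)%N then v (inord (swapn k.-1 k i)) z
  else if k == r.+1 then v ord_max z - (if (i < r)%N then v i z else 0)
  else if k == r.+2 then (if (i < r)%N then u i 0%N else 1) * v i z
  else v i z.
Proof.
rewrite /frame_mx; case: ifP => [/andP[k0 kr]|_].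
  rewrite -row_permE mxE; congr (v _ _); rewrite /swapn.
  case: tpermP => [->|->|/eqP ni /eqP ni'].
  - by rewrite inordK ?eqxx //; lia.
  - rewrite inordK ?eqxx; last by lia.
    by case: ifP => // /eqP ?; lia.
  - rewrite -val_eqE /= inordK in ni; last by lia.
    rewrite -val_eqE /= inordK in ni'; last by lia.
    by rewrite (negbTE ni) (negbTE ni') inord_val.
case: ifP => [_|_].
  rewrite mxE big_ord_recr /= mxE ltnn mul1r addrC; congr (_ + _).
  under eq_bigr => j _ do rewrite mxE /= ltn_ord.
  case: ifP => [ir|ir].
    rewrite (bigD1 (Ordinal ir)) //= big1 ?addr0.
      rewrite (_ : i == _); last by rewrite -val_eqE.
      by rewrite mulN1r; congr (- v _ _); apply: val_inj.
    move=> j; rewrite -val_eqE /= => ji.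
    by rewrite -val_eqE /= eq_sym (negbTE ji) oppr0 mul0r.
  rewrite big1 ?oppr0 // => j _; rewrite -val_eqE /= gtn_eqF ?oppr0 ?mul0r //.
  by have := ltn_ord j; lia.
case: ifP => [_|_]; last by rewrite mul1mx.
by rewrite mul_diag_mx !mxE.
Qed.

Ltac stdcoord_cases :=
  rewrite /stdcoord /coord_act /swapn; repeat case: ifP => ? //; try (exfalso; lia).

Lemma stdcoord_swap_rows l i : (0 < k < r)%N -> (i < r.+1)%N ->
  stdcoord r u (swapn k.-1 k l) i = stdcoord r (coord_act r k u) l (swapn k.-1 k i).
Proof.
move=> kr ir; have [lr|rl] := ltnP r l.
  rewrite (_ : swapn k.-1 k l = l); last by rewrite /swapn; repeat case: ifP => ?; lia.
  rewrite {1}/swapn; case: (i =P k.-1) => ?; case: (i =P k) => ?;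
  stdcoord_cases; by congr (u _ _); lia.
have sl a : (a <= r)%N -> (swapn k.-1 k a <= r)%N.
  by rewrite /swapn; repeat case: ifP => ?; lia.
rewrite /stdcoord !ltnS rl sl //; congr (_%:R).
by rewrite /swapn; repeat case: ifP => ?; lia.
Qed.

Lemma stdcoord_swap_last l i : (k == r) -> (l < N)%N -> (i < r.+1)%N ->
  stdcoord r u (swapn r.-1 r l) i =
  (if (r.+1 < l)%N then u r.-1 (l - r.+2)%N else 1) *
    stdcoord r (coord_act r k u) l (swapn r.-1 r i).
Proof.
move=> /eqP-> lN ir.
have ur : (r.+1 < l)%N -> u r.-1 (l - r.+2)%N != 0 by move=> rl; apply: u0; lia.
have [rl|rl] := ltnP r.+1 l.
  rewrite (_ : swapn r.-1 r l = l); last by rewrite /swapn; repeat case: ifP => ?; lia.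
  rewrite {1}/swapn; case: (i =P r.-1) => ?; case: (i =P r) => ?;
  stdcoord_cases; rewrite ?mulr1 //;
  by first [congr (u _ _); lia | rewrite divff ?ur | rewrite mulrCA divff ?mulr1 ?ur].
rewrite mul1r; have [->|lr1] := eqVneq l r.+1.
  rewrite (_ : swapn r.-1 r r.+1 = r.+1) /stdcoord ?ltnn ?eqxx //.
  by rewrite /swapn; repeat case: ifP => ?; lia.
have sl a : (a <= r)%N -> (swapn r.-1 r a <= r)%N.
  by rewrite /swapn; repeat case: ifP => ?; lia.
have lr : (l <= r)%N by lia.
rewrite /stdcoord !ltnS lr !sl //; congr (_%:R).
by rewrite /swapn; repeat case: ifP => ?; lia.
Qed.

Lemma stdcoord_swap_unit l i : (i < r.+1)%N ->
  stdcoord r u (swapn r r.+1 l) i =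
  (if (l < r)%N then -1 else 1) *
    (stdcoord r (coord_act r r.+1 u) l r -
     (if (i < r)%N then stdcoord r (coord_act r r.+1 u) l i else 0)).
Proof.
move=> ir.
have uE a b : coord_act r r.+1 u a b = 1 - u a b.
  by rewrite /coord_act /= ltnNge leqnSn gtn_eqF // eqxx.
have [lr|lr|->] := ltngtP l r.
- rewrite (_ : swapn r r.+1 l = l); last by rewrite /swapn; repeat case: ifP => ?; lia.
  rewrite /stdcoord ltnS ltnW // (gtn_eqF lr) mulN1r opprB subr0.
  by case: ifP => // ir'; rewrite gtn_eqF //; lia.
- have [->|lr1] := eqVneq l r.+1.
    rewrite (_ : swapn r r.+1 r.+1 = r); last by rewrite /swapn; repeat case: ifP => ?; lia.
    rewrite /stdcoord ltnSn ltnn eqxx mul1r; case: ifP => ir'.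
      by rewrite subrr ltn_eqF.
    by rewrite subr0 (_ : i == r) //; lia.
  rewrite (_ : swapn r r.+1 l = l); last by rewrite /swapn; repeat case: ifP => ?; lia.
  rewrite /stdcoord ltnS leqNgt lr /= (negbTE lr1) ltnn mul1r.
  by case: ifP; rewrite ?uE ?subKr ?subr0.
- rewrite (_ : swapn r r.+1 r = r.+1); last by rewrite /swapn; repeat case: ifP => ?; lia.
  rewrite /stdcoord ltnSn !ltnn !eqxx mul1r.
  by case: ifP => ir'; rewrite ?(ltn_eqF ir') subr0.
Qed.

Lemma stdcoord_swap_unit_next l i : (i < r.+1)%N -> (r.+2 < N)%N ->
  stdcoord r u (swapn r.+1 r.+2 l) i =
  (if (l < r)%N then (u l 0%N)^-1 else 1) *
    ((if (i < r)%N then u i 0%N else 1) * stdcoord r (coord_act r r.+2 u) l i).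
Proof.
move=> ir rN.
have ur a : (a < r)%N -> u a 0%N != 0 by move=> rl; apply: u0; lia.
have uE a b : coord_act r r.+2 u a b = if b == 0%N then (u a 0%N)^-1 else u a b / u a 0%N.
  rewrite /coord_act /= eqxx gtn_eqF // (_ : r.+2 < r = false)%N; last by lia.
  by rewrite gtn_eqF.
have [lr|lr] := ltnP l r.+1.
  rewrite (_ : swapn r.+1 r.+2 l = l); last by rewrite /swapn; repeat case: ifP => ?; lia.
  rewrite /stdcoord lr; have [->|il] := eqVneq i l; last by rewrite !mulr0.
  by case: ifP => lr'; rewrite ?mulr1 // mulVf ?ur.
rewrite [X in X * _](_ : _ = 1) ?mul1r; last by case: ifP => //; lia.
have [->|lr1] := eqVneq l r.+1.
  rewrite (_ : swapn r.+1 r.+2 r.+1 = r.+2); last by rewrite /swapn eqxx.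
  rewrite /stdcoord !ltnn eqxx mulr1 (gtn_eqF (ltnSn _)) subnn.
  by rewrite (_ : r.+2 < r.+1 = false)%N //; lia.
have [->|lr2] := eqVneq l r.+2.
  rewrite (_ : swapn r.+1 r.+2 r.+2 = r.+1); last by rewrite /swapn; repeat case: ifP => ?; lia.
  rewrite /stdcoord !ltnn eqxx (gtn_eqF (ltnSn _)) subnn.
  rewrite (_ : r.+2 < r.+1 = false)%N; last by lia.
  by case: ifP => ir'; rewrite ?mulr1 // uE divff ?ur.
rewrite (_ : swapn r.+1 r.+2 l = l); last by rewrite /swapn; repeat case: ifP => ?; lia.
rewrite /stdcoord ltnNge lr (negbTE lr1) /=; case: ifP => ir'; rewrite ?mulr1 // uE.
by rewrite (_ : (l - r.+2 == 0)%N = false) 1?mulrCA ?divff ?mulr1 ?ur //; lia.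
Qed.

Lemma stdcoord_swap_cols l i : (r.+2 < k)%N ->
  stdcoord r u (swapn k.-1 k l) i = stdcoord r (coord_act r k u) l i.
Proof.
move=> rk.
have uE a b : coord_act r k u a b = u a (swapn (k - r.+3) (k - r.+2) b).
  by rewrite /coord_act; do 5?[case: ifP => [?|_]; first by exfalso; lia].
have [lr|lr] := leqP l r.+1.
  rewrite (_ : swapn _ _ l = l); last by rewrite /swapn; repeat case: ifP => ?; lia.
  by rewrite /stdcoord; do 2?case: ifP => //; lia.
have ls : (r.+1 < swapn k.-1 k l)%N by rewrite /swapn; repeat case: ifP => ?; lia.
rewrite /stdcoord !(leq_gtF (ltnW lr), leq_gtF (ltnW ls)) !gtn_eqF //= uE; case: ifP => // _.
by congr (u _ _); rewrite /swapn; repeat case: ifP => ?; lia.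
Qed.

(** The cases follow which points, numbered from 0, are exchanged: two coordinate points for 0 < k
    <= r, where k = r involves the last coordinate and so a renormalization; the last coordinate
    point and the unit point for k = r+1; the unit point and the first free point for k = r+2; two
    free points beyond. For k = 0 the Cremona transformation preserves the standard form. *)
Lemma gen_pts_frame l : (r.+1 < N)%N -> (l < N)%N ->
  gen_pts k (stdpts r u) l =
  frame_scale r k u l *: (frame_mx r k u *m stdpts r (coord_act r k u) l).
Proof.
move=> rN lN; apply/matrixP => i z; rewrite ord1 {z} mxE frame_mxE.
have ir := ltn_ord i.
have EP (Q : nat -> 'cV[F]_r.+1) a b : (if a then Q b else \col_j (Q b j 0)^-1) i 0 =
  if a then Q b i 0 else (Q b i 0)^-1 by case: a; rewrite // mxE.
rewrite /gen_pts /frame_scale; have [k0|k0] := eqVneq k 0%N.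
  rewrite EP k0 r0 /= mul1r !mxE /stdcoord /coord_act /=.
  by repeat case: ifP => ? //; rewrite ?invr1 //; exfalso; lia.
have -> : stdpts r u (if l == k.-1 then k else if l == k then k.-1 else l) i 0 =
  stdcoord r u (swapn k.-1 k l) i by rewrite mxE.
have sl : (swapn k.-1 k i < r.+1)%N || (r < k)%N.
  by rewrite /swapn; repeat case: ifP => ?; lia.
rewrite !mxE; have [kr|kr] := ltnP k r.
  rewrite (_ : 0 < k <= r)%N; last by lia.
  by rewrite mul1r inordK ?stdcoord_swap_rows //; lia.
have [{}kr|kr'] := eqVneq k r.
  rewrite (_ : 0 < k <= r)%N ?inordK; try lia.
  by move: sl; rewrite kr => sl; rewrite stdcoord_swap_last ?kr.
rewrite (_ : 0 < k <= r = false)%N; last by lia.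
have [{}kr|kr''] := eqVneq k r.+1; first by rewrite kr stdcoord_swap_unit.
have [{}kr|kr'''] := eqVneq k r.+2.
  by rewrite kr stdcoord_swap_unit_next //; lia.
by rewrite mul1r stdcoord_swap_cols //; lia.
Qed.

Lemma frame_mx_unit : frame_mx r k u \in unitmx.
Proof.
rewrite /frame_mx; case: ifP => _; first exact: unitmx_perm.
have [kr|kr] := eqVneq k r.+1.
  (* This frame sends v to the vector with entries v_r - v_i for i < r and last entry v_r, a map of
     order two. *)
  suff E : frame_mx r k u *m frame_mx r k u = 1%:M.
    by move: (mulmx1_unit E) => -[]; rewrite {1}/frame_mx kr ltnn eqxx.
  rewrite -[LHS]mulmx1 -mulmxA; apply/matrixP => i z; rewrite !frame_mxE.
  rewrite (_ : 0 < k <= r = false)%N ?kr ?eqxx; last by lia.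
  rewrite ltnn subr0; case: (ltnP i r) => ir; rewrite ?subKr // subr0.
  by congr (1%:M _ _); apply: val_inj => /=; have := ltn_ord i; lia.
have [kr'|kr'] := eqVneq k r.+2; last exact: unitmx1.
rewrite unitmxE det_diag unitfE; apply/prodf_neq0 => i _; rewrite mxE.
by case: ifP => ir; rewrite ?oner_eq0 // u0 //; lia.
Qed.

End Frame.

Lemma swapnK a b : involutive (swapn a b).
Proof.
move=> i; rewrite /swapn; case: (i =P a) => [->|]; first by rewrite eqxx; case: (b =P a).
by case: (i =P b) => [->|/eqP/negbTE-> /eqP/negbTE->] //; rewrite eqxx.
Qed.

(** The matrix of the first r+1 points is h times the diagonal of the [lam], and the correction by
    the unit point turns this diagonal into the scalar [lam r.+1]. Hence [normalize] inverts h up to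
    a scalar, which disappears on dividing by the last coordinate. *)
Lemma normalize_frame (r N : nat) (F : fieldType) (P : nat -> 'cV[F]_r.+1)
    (h : 'M[F]_r.+1) (lam : nat -> F) (u : nat -> nat -> F) i j :
  h \in unitmx -> (forall l, (l < N)%N -> lam l != 0) ->
  (forall l, (l < N)%N -> P l = lam l *: (h *m stdpts r u l)) ->
  (i < r)%N -> (j < N - r.+2)%N -> normalize P i j = u i j.
Proof.
move=> hU lam0 PE ir jN; rewrite /normalize; set A := \matrix_(_, _) _.
have lamr := lam0 r.+1 ltac:(lia).
have AE : A = h *m diag_mx (\row_(k < r.+1) lam k).
  apply/matrixP => a b; rewrite mul_mx_diag !mxE PE; last by have := ltn_ord b; lia.
  rewrite !mxE mulrC; congr (_ * _); rewrite (bigD1 b) //= mxE /stdcoord ltn_ord eqxx mulr1.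
  by rewrite big1 ?addr0 // => c cb; rewrite mxE /stdcoord ltn_ord (_ : (c == b :> nat) = false) ?mulr0 //; apply: negbTE.
have AU : A \in unitmx.
  rewrite AE unitmx_mul hU unitmxE det_diag unitfE; apply/prodf_neq0 => k _.
  by rewrite mxE lam0 //; have := ltn_ord k; lia.
have PrE : P r.+1 = A *m (\col_(k < r.+1) (lam r.+1 / lam k)).
  rewrite AE -mulmxA PE; last by lia.
  rewrite scalemxAr; congr (h *m _); apply/matrixP => a b.
  rewrite mul_diag_mx !mxE /stdcoord ltnn eqxx mulr1 mulrCA divff ?mulr1 //.
  by rewrite lam0 //; have := ltn_ord a; lia.
have BE : A *m diag_mx (invmx A *m P r.+1)^T = lam r.+1 *: h.
  rewrite PrE mulKmx // AE; apply/matrixP => a b; rewrite !mul_mx_diag !mxE.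
  rewrite -mulrA [lam b * _]mulrCA divff ?mulr1 1?mulrC //.
  by rewrite lam0 //; have := ltn_ord b; lia.
rewrite BE PE; last by lia.
rewrite invmxZ //; last by rewrite unitmxZ ?unitfE.
rewrite -!scalemxAl -!scalemxAr !mulKmx // !mxE.
rewrite inordK; last by lia.
rewrite /stdcoord (_ : r.+2 + j < r.+1 = false)%N; last by lia.
rewrite (_ : r.+2 + j == r.+1 = false)%N; last by lia.
rewrite ir ltnn mulr1 addKn; have := lam0 (r.+2 + j)%N ltac:(lia).
by move: lamr; move: (lam r.+1) (lam _) => x y x0 y0; field; apply/andP; split.
Qed.

Lemma coord_act_rmorph (r N k : nat) (F E : fieldType) (s : {rmorphism F -> E})
    (u : nat -> nat -> F) (u' : nat -> nat -> E) i j :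
  (0 < r)%N -> (k < N)%N ->
  (forall i j, (i < r)%N -> (j < N - r.+2)%N -> s (u i j) = u' i j) ->
  (i < r)%N -> (j < N - r.+2)%N -> s (coord_act r k u i j) = coord_act r k u' i j.
Proof.
move=> r0 kN su ir jN; rewrite /coord_act /swapn.
by repeat case: ifP => ?; rewrite ?fmorph_div ?fmorphV ?rmorphB ?rmorph1 ?su //; lia.
Qed.

Lemma coord_actK (r N k : nat) (F : fieldType) (u : nat -> nat -> F) i j :
  (0 < r)%N -> (k < N)%N ->
  (forall i j, (i < r)%N -> (j < N - r.+2)%N -> u i j != 0) ->
  (i < r)%N -> (j < N - r.+2)%N ->
  coord_act r k (coord_act r k u) i j = u i j.
Proof.
move=> r0 kN u0 ir jN; rewrite /coord_act.
case: (k =P 0%N) => /= [_|k0]; first by rewrite invrK.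
case: (ltnP k r) => /= kr.
  by rewrite swapnK.
case: (k =P r) => /= kr'.
  rewrite eqxx; case: (i =P r.-1) => /= [->|_]; first by rewrite invrK.
  by rewrite invrK mulfVK // u0 //; lia.
case: (k =P r.+1) => /= kr''; first by rewrite subKr.
case: (k =P r.+2) => /= kr'''.
  case: (j =P 0%N) => /= [->|_]; first by rewrite invrK.
  by rewrite invrK mulfVK // u0 //; lia.
by rewrite swapnK.
Qed.

(** For k = r+1 the formula 1 - u is polynomial; the non-vanishing hypothesis covers the values of k
    for which [coord_act] may divide. *)
Lemma coord_act_rel (r N k : nat) (R : idomainType) (K : fieldType) (ev : {rmorphism R -> K})
    (u : nat -> nat -> {fraction R}) (u' : nat -> nat -> K) i j :
  (0 < r)%N -> (k < N)%N ->
  (forall i j, (i < r)%N -> (j < N - r.+2)%N -> frac_rel ev (u i j) (u' i j)) ->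
  (k != r.+1 -> forall i j, (i < r)%N -> (j < N - r.+2)%N -> u' i j != 0) ->
  (i < r)%N -> (j < N - r.+2)%N ->
  frac_rel ev (coord_act r k u i j) (coord_act r k u' i j).
Proof.
move=> r0 kN uu u'0 ir jN; rewrite /coord_act /swapn.
repeat case: ifP => ?; repeat (first [apply: frac_relM | apply: frac_relD | apply: frac_relN
  | exact: frac_rel1 | apply: frac_relV | apply: uu | apply: u'0]); lia.
Qed.

(** * The field automorphism induced by a generator *)

Section Coordvar.
Variables (r N : nat).
Hypothesis r0 : (0 < r)%N.
Local Notation cv := (coordvar r.+1 N).

Lemma nvars_bound (v : 'I_(nvars r.+1 N)) : (v %% r < r)%N && (v %/ r < N - r.+2)%N.
Proof. by rewrite ltn_pmod //= ltn_divLR // mulnC; have := ltn_ord v. Qed.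

Lemma coordvar_div (v : 'I_(nvars r.+1 N)) :
  cv (v %% r)%N (v %/ r)%N = FracField.tofrac 'X_v.
Proof.
rewrite /coordvar /= nvars_bound.
have E : (v %% r + r * (v %/ r))%N = v by rewrite addnC mulnC -divn_eq.
by rewrite E valK.
Qed.

Lemma coordvarP i j : (i < r)%N -> (j < N - r.+2)%N ->
  exists v : 'I_(nvars r.+1 N), [/\ (v %% r = i)%N, (v %/ r = j)%N
    & cv i j = FracField.tofrac 'X_v].
Proof.
move=> ir jN; have lt_v : (i + r * j < nvars r.+1 N)%N.
  rewrite /nvars /=; apply: (@leq_trans (r * j.+1)); last by rewrite leq_mul2l jN orbT.
  by rewrite mulnS ltn_add2r.
have vr : (Ordinal lt_v %% r = i)%N by rewrite /= addnC mulnC modnMDl modn_small.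
have vd : (Ordinal lt_v %/ r = j)%N.
  by rewrite /= addnC mulnC divnMDl // divn_small ?addn0.
by exists (Ordinal lt_v); split=> //; rewrite -coordvar_div vr vd.
Qed.

Lemma coordvar_neq0 i j : (i < r)%N -> (j < N - r.+2)%N -> cv i j != 0.
Proof.
move=> ir jN; have [v [_ _ ->]] := coordvarP ir jN.
by rewrite tofrac_eq0 -msupp_eq0 msuppX.
Qed.

Hypothesis rN : (r.+1 < N)%N.

(** By [normalize_frame] the action is the substitution of [coord_act] into the variables, and
    [coord_actK] makes that substitution an involution, hence injective on polynomials. *)
Lemma gen_act_rmorphism k : (k < N)%N ->
  exists s : {rmorphism cfield r.+1 N -> cfield r.+1 N},
    [/\ @gen_act r.+1 N k =1 s, involutive s, forall c, s (cst _ c) = cst _ c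
      & forall i j, (i < r)%N -> (j < N - r.+2)%N -> s (cv i j) = coord_act r k cv i j].
Proof.
move=> kN; pose h (v : 'I_(nvars r.+1 N)) := coord_act r k cv (v %% r)%N (v %/ r)%N.
have gE phi : @gen_act r.+1 N k phi = frac_eval (@cst _) h phi.
  rewrite /gen_act /frac_eval; congr (_ / _); apply: eq_mmap => // v;
  have /andP[vr vN] := nvars_bound v;
  exact: (normalize_frame (frame_mx_unit r0 kN coordvar_neq0)
   (frame_scale_neq0 r0 kN coordvar_neq0)
   (fun l => gen_pts_frame r0 kN coordvar_neq0 rN (l := l)) vr vN).
have hK v : frac_rel (mmap (@cst _) h) (h v) (FracField.tofrac 'X_v).
  have /andP[vr vN] := nvars_bound v; rewrite -coordvar_div.
  rewrite -(coord_actK r0 kN coordvar_neq0 vr vN).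
  apply: (coord_act_rel (N := N)) => // [i j ir jN|kr].
    have [w [wi wj ->]] := coordvarP ir jN.
    have := frac_rel_tofrac (mmap (@cst _) h) 'X_w.
    by rewrite /= mmapX mmap1U /h wi wj.
  move=> i j ir jN; rewrite /coord_act /swapn (negbTE kr).
  by repeat case: ifP => ?; rewrite ?mulf_neq0 ?invr_eq0 ?coordvar_neq0 //; lia.
pose s : {rmorphism cfield r.+1 N -> cfield r.+1 N} := frac_hom (frac_rel_inj hK).
have sE phi : s phi = frac_eval (@cst _) h phi by [].
exists s; split.
- by move=> x; rewrite gE.
- exact: (frac_eval_invol hK).
- by move=> c; rewrite sE /cst (frac_eval_tofrac (frac_rel_inj hK)) mmapC.
- move=> i j ir jN; have [w [wi wj ->]] := coordvarP ir jN.
  by rewrite sE (frac_eval_tofrac (frac_rel_inj hK)) mmapX mmap1U /h wi wj.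
Qed.

End Coordvar.

(** * The equivariant embedding of the function field of n points into that of n+1 points *)

Section EmbK.
Variables (r n : nat).
Hypotheses (r0 : (0 < r)%N) (rn : (r.+1 < n)%N).
Local Notation cv := (coordvar r.+1 n).
Local Notation cv' := (coordvar r.+1 n.+1).

(** The variable number i + r j does not depend on the number of points, so the embedding merely
    widens indices. Sending the additional variables to 0 ([back]) is a left inverse. *)
Lemma embK_mmap_neq0 (p : {mpoly CC[nvars r.+1 n]}) : p != 0 ->
  mmap (@cst (nvars r.+1 n.+1))
    (fun v : 'I_(nvars r.+1 n) => cv' (v %% r)%N (v %/ r)%N) p != 0.
Proof.
have le_nv : (nvars r.+1 n <= nvars r.+1 n.+1)%N.
  by rewrite /nvars /= leq_mul2l leq_sub2r ?orbT.
pose q : {mpoly CC[nvars r.+1 n.+1]} :=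
  mmap (@mpolyC _ CC) (fun v => 'X_(widen_ord le_nv v)) p.
have -> : mmap (@cst (nvars r.+1 n.+1))
    (fun v : 'I_(nvars r.+1 n) => cv' (v %% r)%N (v %/ r)%N) p = FracField.tofrac q.
  rewrite rmorph_mmap; apply: eq_mmap => // v /=.
  by rewrite -coordvar_div.
rewrite tofrac_eq0; apply: contraNneq => q0.
pose back (w : 'I_(nvars r.+1 n.+1)) : {mpoly CC[nvars r.+1 n]} :=
  if insub (val w) is Some v then 'X_v else 0.
have : mmap (@mpolyC _ CC) back q = p.
  rewrite rmorph_mmap -[RHS]comp_mpoly_id /comp_mpoly; apply: eq_mmap => [c|v] /=.
    by rewrite mmapC.
  by rewrite mmapX mmap1U tnth_mktuple /back /= valK.
by rewrite q0 raddf0 => <-.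
Qed.

Lemma embK_rmorphism :
  exists e : {rmorphism cfield r.+1 n -> cfield r.+1 n.+1},
    [/\ @embK r.+1 n =1 e, forall c, e (cst _ c) = cst _ c
      & forall i j, (i < r)%N -> (j < n - r.+2)%N -> e (cv i j) = cv' i j].
Proof.
pose e : {rmorphism cfield r.+1 n -> cfield r.+1 n.+1} := frac_hom embK_mmap_neq0.
exists e; split=> // [c|i j ir jN].
  by rewrite /e /= /frac_hom /cst (frac_eval_tofrac embK_mmap_neq0) mmapC.
have [w [wi wj ->]] := coordvarP r0 ir jN.
by rewrite /e /= /frac_hom (frac_eval_tofrac embK_mmap_neq0) mmapX mmap1U wi wj.
Qed.

(** For k < n the formulas for the columns of the first n points involve only those columns, so both
    composites agree on the variables. *)
Lemma gen_act_embK k (x : cfield r.+1 n) : (k < n)%N ->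
  @gen_act r.+1 n.+1 k (embK x) = embK (@gen_act r.+1 n k x).
Proof.
move=> kn; have [e [eE ec ecv]] := embK_rmorphism.
have [s [sE _ sc scv]] := gen_act_rmorphism r0 rn kn.
have [s' [s'E _ s'c s'cv]] := gen_act_rmorphism (N := n.+1) r0 (ltnW rn) (ltnW kn).
rewrite s'E sE !eE.
pose f : {rmorphism cfield r.+1 n -> cfield r.+1 n.+1} := s' \o e.
pose g : {rmorphism cfield r.+1 n -> cfield r.+1 n.+1} := e \o s.
suff: f =1 g by move=> /(_ x).
apply: eq_frac_rmorph => [c|v]; rewrite /f /g /=; first by rewrite sc !ec s'c.
have /andP[vr vn] := nvars_bound r0 v; rewrite -coordvar_div // ecv // scv //.
by rewrite s'cv ?(coord_act_rmorph (N := n) _ _ ecv) //; lia.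
Qed.

End EmbK.

(** * Order of vanishing at a point *)

(** Vanishing to order N at the origin; [ord_ge] reduces to it after translating the point there. *)
Definition lowdeg (k : nat) (R : nzRingType) (N : nat) (g : {mpoly R[k]}) : Prop :=
  forall mo : 'X_{1..k}, (mdeg mo < N)%N -> g@_mo = 0.

Definition shift_tuple (k : nat) (R : idomainType) (p : 'I_k -> R) : k.-tuple {mpoly R[k]} :=
  [tuple 'X_i + (p i)%:MP | i < k].

Section OrdGe.
Variable R : idomainType.

Lemma lowdegP k N (g : {mpoly R[k]}) :
  lowdeg N g <-> {in msupp g, forall mo, (N <= mdeg mo)%N}.
Proof.
split=> [lg mo|lg mo lt]; first by rewrite leqNgt mcoeff_msupp; apply: contra => /lg->.
by apply: memN_msupp_eq0; apply: contraL lt => /lg; rewrite -leqNgt.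
Qed.

Lemma lowdeg0 k (g : {mpoly R[k]}) : lowdeg 0 g. Proof. by []. Qed.

Lemma lowdegW k N N' (g : {mpoly R[k]}) : (N' <= N)%N -> lowdeg N g -> lowdeg N' g.
Proof. by move=> le lg mo lt; apply: lg; apply: leq_trans le. Qed.

Lemma lowdeg_sum k N (I : eqType) (s : seq I) (g : I -> {mpoly R[k]}) :
  {in s, forall i, lowdeg N (g i)} -> lowdeg N (\sum_(i <- s) g i).
Proof.
move=> lg mo lt; rewrite raddf_sum big_seq big1 // => i si.
exact: lg.
Qed.

Lemma lowdegM k N N' (g g' : {mpoly R[k]}) :
  lowdeg N g -> lowdeg N' g' -> lowdeg (N + N') (g * g').
Proof.
move=> /lowdegP lg /lowdegP lg'; apply/lowdegP => mo /msuppM_le/allpairsP[[m1 m2] /=].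
by move=> [/lg l1 /lg' l2 ->]; rewrite mdegD leq_add.
Qed.

Lemma lowdegX k N e (g : {mpoly R[k]}) : lowdeg N g -> lowdeg (e * N) (g ^+ e).
Proof.
move=> lg; elim: e => [|e IHe]; first exact: lowdeg0.
by rewrite exprS mulSn; apply: lowdegM.
Qed.

Lemma lowdegZ k N c (g : {mpoly R[k]}) : lowdeg N g -> lowdeg N (c *: g).
Proof. by move=> lg mo lt; rewrite mcoeffZ lg ?mulr0. Qed.

Lemma lowdeg_prod k l (e : 'I_l -> nat) (g : 'I_l -> {mpoly R[k]}) :
  (forall i, lowdeg (e i) (g i)) -> lowdeg (\sum_i e i) (\prod_i g i).
Proof.
move=> lg; elim/big_rec2: _ => [|i N p _ lp]; first exact: lowdeg0.
exact: lowdegM.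
Qed.

Lemma lowdeg_comp k l N (f : {mpoly R[k]}) (g : k.-tuple {mpoly R[l]}) :
  lowdeg N f -> (forall i, lowdeg 1 (tnth g i)) -> lowdeg N (f \mPo g).
Proof.
move=> /lowdegP lf lg; rewrite comp_mpolyEX; apply: lowdeg_sum => mo /lf le.
apply/lowdegZ/(lowdegW le); rewrite comp_mpolyX mdegE.
by apply: lowdeg_prod => i; rewrite -[X in lowdeg X _]muln1; apply: lowdegX.
Qed.

Lemma comp_mpolyA k l p (f : {mpoly R[k]}) (g : k.-tuple {mpoly R[l]})
    (h : l.-tuple {mpoly R[p]}) :
  (f \mPo g) \mPo h = f \mPo [tuple tnth g i \mPo h | i < k].
Proof.
rewrite /(f \mPo g) /(f \mPo [tuple _ | _ < _]) rmorph_mmap; apply: eq_mmap => [c|i] /=.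
  by rewrite comp_mpolyC.
by rewrite tnth_mktuple.
Qed.

Lemma eq_comp_mpoly k l (f : {mpoly R[k]}) (g h : k.-tuple {mpoly R[l]}) :
  (forall i, tnth g i = tnth h i) -> f \mPo g = f \mPo h.
Proof. by move=> gh; congr (_ \mPo _); apply: eq_from_tnth. Qed.

Lemma mcoeff0_shift k (f : {mpoly R[k]}) (p : 'I_k -> R) :
  (f \mPo shift_tuple p)@_0 = f.@[p].
Proof.
rewrite /comp_mpoly /meval -[LHS]/(mcoeff 0%MM (mmap _ _ f)) rmorph_mmap.
apply: eq_mmap => [c|i] /=; first by rewrite mcoeffC eqxx mulr1.
by rewrite tnth_mktuple mcoeffD mcoeffC eqxx mulr1 mcoeffX -mdeg_eq0 mdeg1 add0r.
Qed.

Lemma ord_geP k (f : {mpoly R[k]}) (p : 'I_k -> R) (nu : int) :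
  ord_ge f p nu <-> lowdeg (if (0 <= nu)%R then absz nu else 0%N) (f \mPo shift_tuple p).
Proof. by case: nu => nu; split=> lf mo lt; apply: lf. Qed.

(** Expand f around p' and substitute g(X + p) - p'. These polynomials have no constant term, so
    substitution cannot lower the order. *)
Lemma ord_ge_comp k l (f : {mpoly R[k]}) (g : k.-tuple {mpoly R[l]}) (p : 'I_l -> R)
    (p' : 'I_k -> R) nu :
  (forall i, (tnth g i).@[p] = p' i) -> ord_ge f p' nu -> ord_ge (f \mPo g) p nu.
Proof.
move=> gp /ord_geP lf; apply/ord_geP; rewrite comp_mpolyA.
pose h := [tuple (tnth g i \mPo shift_tuple p) - (p' i)%:MP | i < k].
have -> : f \mPo [tuple tnth g i \mPo shift_tuple p | i < k] = (f \mPo shift_tuple p') \mPo h.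
  rewrite comp_mpolyA; apply: eq_comp_mpoly => i; rewrite !tnth_mktuple.
  by rewrite comp_mpolyD comp_mpolyC comp_mpolyXU -tnth_nth tnth_mktuple subrK.
apply: lowdeg_comp => // i mo; rewrite ltnS leqn0 mdeg_eq0 => /eqP->.
by rewrite tnth_mktuple mcoeffB mcoeff0_shift gp mcoeffC eqxx mulr1 subrr.
Qed.

Lemma ord_geZ k (f : {mpoly R[k]}) (p : 'I_k -> R) nu c :
  ord_ge f p nu -> ord_ge (c *: f) p nu.
Proof. by move=> of_ mo lt; rewrite comp_mpolyZ mcoeffZ of_ ?mulr0. Qed.

Lemma ord_ge_eq k (f : {mpoly R[k]}) (p q : 'I_k -> R) nu :
  p =1 q -> ord_ge f p nu -> ord_ge f q nu.
Proof.
move=> pq of_ mo lt; rewrite -(of_ _ lt); congr (_@_mo); apply: eq_comp_mpoly => i.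
by rewrite !tnth_mktuple pq.
Qed.

(** After translation X_i becomes X_i + p_i, so a coefficient of the product is p_i times that of f
    plus a coefficient of f in degree one less. The latter vanishes by induction, and p_i is
    nonzero. *)
Lemma ord_ge_cancelX k (f : {mpoly R[k]}) (p : 'I_k -> R) nu i :
  p i != 0 -> ord_ge ('X_i * f) p nu -> ord_ge f p nu.
Proof.
move=> pi0 of_ mo; have [d] := ubnP (mdeg mo).
elim: d mo => // d IHd mo; rewrite ltnS => le_d lt_nu.
have := of_ mo lt_nu; rewrite rmorphM /= comp_mpolyXU -tnth_nth tnth_mktuple mulrDl mcoeffD.
rewrite mcoeffCM => /eqP; rewrite addrC; set g := f \mPo _.
have -> : ('X_i * g)@_mo = 0.
  have [le|nle] := boolP (U_(i) <= mo)%MM; last first.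
    apply/eqP; rewrite mcoeff_eq0; apply: contra nle => /msuppM_le/allpairsP[[m1 m2] /=].
    by rewrite msuppX inE => -[/eqP-> _ ->]; apply: lem_addr.
  have <- : (mo - U_(i) + U_(i) = mo)%MM by rewrite submK.
  have lt : (mdeg (mo - U_(i))%MM < mdeg mo)%N.
    by rewrite -[in X in (_ < X)%N](submK le) mdegD mdeg1 addn1.
  rewrite mulrC addmC mcoeffMX; apply: IHd; first exact: leq_trans lt le_d.
  by apply: lt_trans lt_nu; rewrite ltz_nat.
by rewrite addr0 mulf_eq0 (negbTE pi0) => /eqP.
Qed.

Lemma ord_ge_cancelXm k (f : {mpoly R[k]}) (p : 'I_k -> R) nu (mo : 'X_{1..k}) :
  (forall i, mo i != 0%N -> p i != 0) -> ord_ge ('X_[mo] * f) p nu -> ord_ge f p nu.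
Proof.
have [d] := ubnP (mdeg mo); elim: d mo => // d IHd mo; rewrite ltnS => le_d p0.
have [->|mo0] := eqVneq mo 0%MM; first by rewrite mpolyX0 mul1r.
have [i moi] : exists i, mo i != 0%N.
  apply/existsP; apply: contraNT mo0 => /existsPn mo0.
  by apply/eqP/mnmP => i; rewrite mnm0E; apply/eqP; rewrite -[_ == _]negbK mo0.
have le : (U_(i) <= mo)%MM by rewrite lep1mP.
have -> : 'X_[mo] * f = 'X_i * ('X_[mo - U_(i)] * f).
  by rewrite mulrA -mpolyXD addmC submK.
move=> of_; apply: (IHd (mo - U_(i))%MM); last exact: ord_ge_cancelX (p0 _ moi) of_.
  by apply: leq_trans le_d; rewrite -[in X in (_ < X)%N](submK le) mdegD mdeg1 addn1.
by move=> j; rewrite mnmBE => mj; apply: p0; apply: contraNneq mj => ->.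
Qed.

End OrdGe.

(** * Homogeneity, linear substitutions and the order at a coordinate point *)

Section Spaces.
Variable R : idomainType.

(** Covers negative degrees uniformly: no monomial has negative degree, so the support is empty and
    f is 0. *)
Lemma homog_of_degP k (d : int) (f : {mpoly R[k]}) :
  homog_of_deg d f <-> {in msupp f, forall mo, (mdeg mo)%:Z = d}.
Proof.
case: d => d; rewrite /homog_of_deg /=.
  split=> [/dhomogP hf mo /hf <- //|hf].
  by apply/dhomogP => mo /hf [].
split=> [/eqP-> mo|hf]; first by rewrite msupp0.
by rewrite -msupp_eq0; case: (msupp f) hf => // mo s /(_ mo (mem_head _ _)).
Qed.

(** For homogeneous f, dividing the variables by c multiplies f by a unit, so the order depends only
    on the projective point. *)
Lemma ord_ge_scale k (d : int) (f : {mpoly R[k]}) (p q : 'I_k -> R) nu (c : R) :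
  homog_of_deg d f -> c \is a GRing.unit -> (forall i, q i = c * p i) ->
  ord_ge f p nu -> ord_ge f q nu.
Proof.
move=> /homog_of_degP hf cU qE fp.
pose g := [tuple c^-1 *: ('X_i : {mpoly R[k]}) | i < k].
have : ord_ge (f \mPo g) q nu.
  apply: ord_ge_comp fp => i; rewrite tnth_mktuple mevalZ mevalXU qE.
  by rewrite mulKr.
have -> : f \mPo g = c^-1 ^+ absz d *: f.
  rewrite [in RHS](mpolyE f) comp_mpolyEX scaler_sumr.
  apply: eq_big_seq => mo /hf hmo; rewrite scalerA mulrC -scalerA; congr (_ *: _).
  rewrite comp_mpolyX -hmo /= mdegE expr_sum mpolyXE_id -scaler_prod.
  by apply: eq_bigr => i _; rewrite tnth_mktuple exprZn.
move=> fg; have := ord_geZ (c ^+ absz d) fg; rewrite scalerA -exprMn mulrV // expr1n.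
by rewrite scale1r.
Qed.

Definition lsub k (h : 'M[R]_k) (f : {mpoly R[k]}) : {mpoly R[k]} :=
  f \mPo [tuple \sum_j h i j *: 'X_j | i < k].

Lemma lsubM k (h h' : 'M[R]_k) f : lsub h (lsub h' f) = lsub (h' *m h) f.
Proof.
rewrite /lsub comp_mpolyA; apply: eq_comp_mpoly => i; rewrite !tnth_mktuple rmorph_sum /=.
under eq_bigr => j _ do rewrite comp_mpolyZ comp_mpolyXU -tnth_nth tnth_mktuple scaler_sumr.
rewrite exchange_big; apply: eq_bigr => j _ /=; rewrite mxE scaler_suml.
by apply: eq_bigr => l _; rewrite scalerA.
Qed.

Lemma lsub1 k (f : {mpoly R[k]}) : lsub 1%:M f = f.
Proof.
rewrite -[RHS]comp_mpoly_id; apply: eq_comp_mpoly => i; rewrite !tnth_mktuple.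
rewrite (bigD1 i) //= mxE eqxx scale1r big1 ?addr0 // => j ji.
by rewrite mxE eq_sym (negbTE ji) scale0r.
Qed.

Lemma lsubZ k (h : 'M[R]_k) c (f : {mpoly R[k]}) : lsub h (c *: f) = c *: lsub h f.
Proof. exact: comp_mpolyZ. Qed.

Lemma mmap_lsub k (S : comNzRingType) (s : {rmorphism R -> S}) (v : 'I_k -> S)
    (h : 'M[R]_k) f :
  mmap s v (lsub h f) = mmap s (fun i => \sum_j s (h i j) * v j) f.
Proof.
rewrite /lsub /comp_mpoly rmorph_mmap; apply: eq_mmap => [c|i] /=; first by rewrite mmapC.
rewrite tnth_mktuple rmorph_sum /=; apply: eq_bigr => j _.
by rewrite mmapZ mmapX mmap1U.
Qed.

Lemma lsub_homog k (d : int) (h : 'M[R]_k) (f : {mpoly R[k]}) :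
  homog_of_deg d f -> homog_of_deg d (lsub h f).
Proof.
rewrite /homog_of_deg; case: ifP => [_|_ /eqP->]; last by rewrite /lsub comp_mpoly0.
move=> /dhomogP hf; rewrite /lsub comp_mpolyEX big_seq; apply: rpred_sum => mo mof.
have {mof} -> : absz d = (\sum_i mo i)%N by rewrite -mdegE -(hf _ mof).
apply: rpredZ; rewrite comp_mpolyX.
elim/big_rec2: _ => [|i e p _ IH]; first exact: dhomog1.
apply: dhomogM IH; rewrite -[mo i in X in X.-homog]mul1n; apply: dhomogMn.
rewrite tnth_mktuple; apply: rpred_sum => j _; apply: rpredZ.
by rewrite dhomogX; apply/eqP/mdeg1.
Qed.

Definition clear_var k (j : 'I_k) (mo : 'X_{1..k}) : 'X_{1..k} :=
  [multinom if i == j then 0%N else mo i | i < k].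

Lemma mdeg_clear_var k (j : 'I_k) (mo : 'X_{1..k}) :
  mdeg mo = (mo j + mdeg (clear_var j mo))%N.
Proof.
rewrite !mdegE (bigD1 j) //= [in RHS](bigD1 j) //= mnmE eqxx add0n; congr (_ + _)%N.
by apply: eq_bigr => i /negbTE ij; rewrite mnmE ij.
Qed.

Lemma clear_var_inj k (j : 'I_k) (mo mo' : 'X_{1..k}) :
  mdeg mo = mdeg mo' -> clear_var j mo = clear_var j mo' -> mo = mo'.
Proof.
move=> dE cE; apply/mnmP => i; have [->|ij] := eqVneq i j.
  by move: dE; rewrite (mdeg_clear_var j mo) (mdeg_clear_var j mo') cE => /addIn.
by have /mnmP/(_ i) := cE; rewrite !mnmE (negbTE ij).
Qed.

(** In the chart x_j = 1 a monomial of degree d has order d - mo_j at the j-th coordinate point, and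
    distinct monomials stay distinct. The order condition is therefore a bound on the exponent of
    x_j. *)
Lemma ord_ge_coord_point k (d : int) (f : {mpoly R[k]}) (p : 'I_k -> R) nu (j : 'I_k) :
  homog_of_deg d f -> (forall i, p i = (i == j)%:R) ->
  ord_ge f p nu <-> forall mo : 'X_{1..k}, mo \in msupp f -> (mo j)%:Z <= d - nu.
Proof.
move=> /homog_of_degP hf pE; split=> [/ord_geP lf mo mof|le_f]; last first.
  apply/ord_geP; rewrite comp_mpolyEX; apply: lowdeg_sum => mo mof; apply: lowdegZ.
  apply: (@lowdegW _ _ (mdeg (clear_var j mo))).
    have := le_f _ mof; rewrite -(hf _ mof) (mdeg_clear_var j mo).
    by case: nu {le_f} => nu /=; lia.
  rewrite comp_mpolyX mdegE; apply: lowdeg_prod => i.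
  rewrite mnmE tnth_mktuple pE; have [_|ij] := eqVneq i j; first exact: lowdeg0.
  rewrite addr0 -[X in lowdeg X _]muln1; apply: lowdegX => m'.
  by rewrite ltnS leqn0 mdeg_eq0 => /eqP->; rewrite mcoeffX -mdeg_eq0 mdeg1.
rewrite leNgt; apply/negP => lt_mo.
(* After translation the j-th variable is x_j - 1; setting it to 0 dehomogenizes f and keeps every
   coefficient visible. *)
pose z := [tuple if i == j then 0 else 'X_i : {mpoly R[k]} | i < k].
have z1 i : lowdeg 1 (tnth z i).
  move=> m'; rewrite ltnS leqn0 mdeg_eq0 tnth_mktuple => /eqP->.
  by case: ifP => _; rewrite ?mcoeff0 // mcoeffX -mdeg_eq0 mdeg1.
have := lowdeg_comp lf z1; rewrite comp_mpolyA => /(_ (clear_var j mo)).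
have -> : (f \mPo [tuple tnth (shift_tuple p) i \mPo z | i < k])@_(clear_var j mo) = f@_mo.
  rewrite comp_mpolyEX raddf_sum /= [in RHS](mpolyE f) raddf_sum /=.
  apply: eq_big_seq => m' m'f; rewrite !mcoeffZ mcoeffX; congr (_ * _).
  have -> : 'X_[m'] \mPo [tuple tnth (shift_tuple p) i \mPo z | i < k] = 'X_[clear_var j m'].
    rewrite comp_mpolyX mpolyXE_id; apply: eq_bigr => i _; rewrite !tnth_mktuple mnmE.
    rewrite comp_mpolyD comp_mpolyC comp_mpolyXU -tnth_nth tnth_mktuple pE.
    by have [_|_] := eqVneq i j; rewrite ?addr0 // add0r expr1n expr0.
  rewrite mcoeffX; congr (_%:R); congr nat_of_bool; apply/eqP/eqP => [|-> //].
  apply: clear_var_inj; have := hf _ mof; have := hf _ m'f.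
  by move=> <- [].
move: (mof); rewrite mcoeff_msupp => fm0 f0; move: fm0; rewrite f0 ?eqxx //.
move: lt_mo; rewrite -(hf _ mof) (mdeg_clear_var j mo).
by case: nu {lf f0} => nu /=; lia.
Qed.

End Spaces.

(** * The lattice *)

Section Lattice.
Variables (m n : nat).
Hypothesis mn : (m < n)%N.
Implicit Types L : lat n.

Lemma lat_h0E (i : 'I_n.+1) :
  lat_h m n 0 i = (i == 0 :> nat)%:R - (0 < i <= m)%N%:R.
Proof.
rewrite /lat_h ffunE; congr (_ - _); first by rewrite ffunE.
under eq_bigr => l _ do rewrite ffunE eq_sym.
have [/andP[i0 im]|] := boolP (0 < i <= m)%N.
  rewrite (bigD1_seq (i : nat)) ?iota_uniq ?mem_index_iota ?i0 //= eqxx big1 ?addr0 // => l.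
  by move=> /negbTE->.
by move=> nim; rewrite big_nat big1 // => l /andP[l1 l2]; rewrite [_ == _](_ : _ = false) //; lia.
Qed.

Lemma lat_hSE k (i : 'I_n.+1) : (0 < k)%N ->
  lat_h m n k i = (i == k :> nat)%:R - (i == k.+1 :> nat)%:R.
Proof. by case: k => // k _; rewrite /lat_h /= !ffunE. Qed.

Lemma lat_form0E L :
  lat_form m (lat_h m n 0) L = (2 - m%:Z) * L ord0 - \sum_(i < m) L (inord i.+1).
Proof.
rewrite /lat_form lat_h0E /= subr0 mulr1; congr (_ + _).
rewrite (big_ord_widen n (fun i => L (inord i.+1))) ?(ltnW mn) // -sumrN big_mkcond /=.
rewrite big_ord_recl /= add0r [RHS]big_mkcond; apply: eq_bigr => i _ /=.
rewrite lat_h0E /= /bump /= add1n sub0r mulNr.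
have -> : lift ord0 i = inord i.+1 by apply: val_inj; rewrite /= inordK // ltnS ltn_ord.
by case: ifP => _; rewrite ?mul1r ?mul0r ?oppr0.
Qed.

Lemma lat_refl0E L (i : 'I_n.+1) :
  lat_refl m 0 L i =
  L i - ((2 - m%:Z) * L ord0 - \sum_(i < m) L (inord i.+1)) *
    ((i == 0 :> nat)%:R - (0 < i <= m)%N%:R).
Proof. by rewrite ffunE lat_form0E lat_h0E. Qed.

Lemma lat_reflSE k L (i : 'I_n.+1) : (0 < k < n)%N ->
  lat_refl m k L i = L (inord (swapn k k.+1 i)).
Proof.
move=> /andP[k0 kn]; rewrite ffunE.
have -> : lat_form m (lat_h m n k) L = L (inord k) - L (inord k.+1).
  rewrite /lat_form lat_hSE // !ltn_eqF //= subr0 mulr0 mul0r add0r.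
  have E (l : nat) : (0 < l < n.+1)%N ->
    \sum_(j < n.+1 | (0 < j)%N) (j == l :> nat)%:R * L j = L (inord l).
    move=> /andP[l0 ln]; rewrite (bigD1 (inord l)) /= ?inordK // eqxx mul1r big1 ?addr0 //.
    move=> j /andP[_]; rewrite -val_eqE /= inordK // => /negbTE->.
    by rewrite mul0r.
  under eq_bigr => j _ do rewrite lat_hSE // mulrBl.
  by rewrite big_split /= sumrN !E //; lia.
rewrite lat_hSE // /swapn.
have ii : L i = L (inord i) by rewrite inord_val.
have [ik|ik] := eqVneq (i : nat) k.
  by rewrite ltn_eqF ?ik // subr0 mulr1 ii ik subKr.
have [ik'|ik'] := eqVneq (i : nat) k.+1.
  by rewrite sub0r mulrN1 ii ik' opprK addrC subrK.
by rewrite subrr mulr0 subr0 -ii.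
Qed.

(** For k = 0 this rests on the norm (2 - m) + m = 2 of h_0; for k > 0 the reflection transposes two
    coordinates. *)
Lemma lat_refl_invol k L : (k < n)%N -> lat_refl m k (lat_refl m k L) = L.
Proof.
move=> kn; apply/ffunP => i; have [k0|] := posnP k; last first.
  move=> k0; rewrite !lat_reflSE ?k0 //; congr (L _); apply: val_inj.
  rewrite /= inordK; rewrite ?inordK ?swapnK //.
    by rewrite /swapn; have := ltn_ord i; repeat case: ifP => ?; lia.
  by rewrite /swapn; have := ltn_ord i; repeat case: ifP => ?; lia.
rewrite k0 !lat_refl0E /=; set S := \sum_(i < m) _.
have -> : \sum_(i0 < m) lat_refl m 0 L (inord i0.+1) =
    S + m%:Z * ((2 - m%:Z) * L ord0 - S).
  have E (j : 'I_m) : lat_refl m 0 L (inord j.+1) =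
      L (inord j.+1) + ((2 - m%:Z) * L ord0 - S).
    rewrite lat_refl0E inordK; last by have := ltn_ord j; lia.
    by rewrite /= ltn_ord sub0r mulrN1 opprK.
  rewrite (eq_bigr _ (fun j _ => E j)) big_split sumr_const card_ord; congr (_ + _).
  by rewrite -[X in X * (_ - S)]natz mulr_natl.
ring.
Qed.

Lemma lat_reflD k L L' : lat_refl m k (L + L') = lat_refl m k L + lat_refl m k L'.
Proof.
apply/ffunP => i; rewrite !ffunE.
have -> : lat_form m (lat_h m n k) (L + L') =
  lat_form m (lat_h m n k) L + lat_form m (lat_h m n k) L'.
  rewrite /lat_form ffunE mulrDr -!addrA; congr (_ + _).
  under eq_bigr => j _ do rewrite ffunE mulrDr.
  by rewrite big_split /= addrCA.
ring.
Qed.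

Lemma lat_actD w L L' : lat_act m w (L + L') = lat_act m w L + lat_act m w L'.
Proof. by elim: w => //= k w ->; rewrite lat_reflD. Qed.

(** The pairing of h_0 with each of e_1, ..., e_m is -1. *)
Lemma lat_refl0_e i : (0 < i <= m)%N ->
  lat_refl m 0 (lat_e n i) = lat_e n i + lat_h m n 0.
Proof.
move=> /andP[i0 im]; apply/ffunP => j.
have iE : (i < n.+1)%N by lia.
have e0 : lat_e n i ord0 = 0 by rewrite ffunE /= ltn_eqF.
rewrite [RHS]ffunE ffunE lat_form0E e0 mulr0 sub0r.
suff -> : \sum_(l < m) lat_e n i (inord l.+1) = 1 by rewrite mulN1r opprK.
have i1m : (i.-1 < m)%N by lia.
rewrite (bigD1 (Ordinal i1m)) //= ffunE prednK // inordK // eqxx big1 ?addr0 // => l.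
rewrite -val_eqE /= ffunE inordK => [li|]; last by have := ltn_ord l; lia.
by rewrite [_ == _](_ : _ = false) //; lia.
Qed.

End Lattice.

(** * The Cremona transformation and the spaces L(Lambda) *)

Lemma mnm_subK k (mo D : 'X_{1..k}) : (mo <= D)%MM -> (D - (D - mo))%MM = mo.
Proof. by move=> /mnm_lepP le; apply/mnmP => i; rewrite !mnmBE subKn. Qed.

(* [x ^ D * f(1 / x)]; the truncated subtraction is exact only when the support of [f] is below [D]. *)
Definition crem (k : nat) (R : idomainType) (D : 'X_{1..k}) (f : {mpoly R[k]}) : {mpoly R[k]} :=
  \sum_(mo <- msupp f) f@_mo *: 'X_[D - mo].

Section Crem.
Variables (k : nat) (R : idomainType) (D : 'X_{1..k}).
Implicit Types f : {mpoly R[k]}.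
Local Notation bounded f := {in msupp f, forall mo, (mo <= D)%MM}.

Lemma mcoeff_crem f mo : bounded f ->
  (crem D f)@_mo = if (mo <= D)%MM then f@_(D - mo) else 0.
Proof.
move=> fD; rewrite /crem raddf_sum /=; case: ifPn => [moD|nmoD].
  rewrite [in RHS](mpolyE f) raddf_sum /=; apply: eq_big_seq => m mf; have mD := fD _ mf.
  rewrite !mcoeffZ !mcoeffX; congr (_ * (nat_of_bool _)%:R).
  by apply/eqP/eqP => [<-|->]; rewrite mnm_subK.
rewrite big_seq big1 // => m mf; rewrite mcoeffZ mcoeffX.
case: eqP => [E|_]; last by rewrite mulr0.
by case/negP: nmoD; rewrite -E; apply/mnm_lepP => i; rewrite mnmBE leq_subr.
Qed.

Lemma msupp_crem f mo : bounded f ->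
  (mo \in msupp (crem D f)) = (mo <= D)%MM && ((D - mo)%MM \in msupp f).
Proof.
by move=> fD; rewrite !mcoeff_msupp mcoeff_crem //; case: ifP; rewrite ?eqxx.
Qed.

Lemma cremK f : bounded f -> crem D (crem D f) = f.
Proof.
move=> fD; apply/mpolyP => mo; rewrite mcoeff_crem; last first.
  by move=> m; rewrite msupp_crem // => /andP[].
case: ifPn => [moD|nmoD].
  rewrite mcoeff_crem // ifT ?mnm_subK //.
  by apply/mnm_lepP => i; rewrite mnmBE leq_subr.
by apply/esym/memN_msupp_eq0; apply: contra nmoD => /fD.
Qed.

Lemma mmap_crem (S : fieldType) (s : {rmorphism R -> S}) (v : 'I_k -> S) f :
  bounded f -> (forall i, v i != 0) ->
  mmap s v (crem D f) = (\prod_i v i ^+ D i) * mmap s (fun i => (v i)^-1) f.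
Proof.
move=> fD v0; rewrite /crem raddf_sum /= [in RHS]/mmap mulr_sumr.
apply: eq_big_seq => mo /fD/mnm_lepP moD; rewrite mmapZ mmapX mulrCA; congr (_ * _).
rewrite /mmap1 -big_split; apply: eq_bigr => i _ /=.
by rewrite mnmBE exprVn expfB_cond // (negbTE (v0 i)) add0n.
Qed.

(** The product of the variables other than x_i is the full product divided by x_i, so f evaluated
    there is the d-th power of the full product times f(1/x). This ties [crem] to a polynomial map,
    to which [ord_ge_comp] applies. *)
Lemma crem_comp f d : homog_of_deg d f -> bounded f ->
  'X_[ [multinom absz d | _ < k] ] * crem D f =
  'X_[D] * (f \mPo [tuple \prod_(l | l != i) 'X_l | i < k]).
Proof.
move=> /homog_of_degP hf fD; rewrite /crem comp_mpolyEX !mulr_sumr.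
apply: eq_big_seq => mo mof; have /mnm_lepP moD := fD _ mof.
rewrite -!scalerAr; congr (_ *: _); rewrite comp_mpolyX.
have dE : absz d = (\sum_i mo i)%N by rewrite -mdegE -(hf _ mof).
have -> : \prod_i tnth [tuple \prod_(l | l != i) ('X_l : {mpoly R[k]}) | i < k] i ^+ mo i =
    'X_[ [multinom (absz d - mo l)%N | l < k] ].
  rewrite mpolyXE_id.
  under eq_bigr => i _ do rewrite tnth_mktuple -prodrXl big_mkcond.
  rewrite exchange_big; apply: eq_bigr => l _ /=; rewrite mnmE.
  have -> : (absz d - mo l = \sum_(i | i != l) mo i)%N by rewrite dE (bigD1 l) //= addKn.
  rewrite -big_mkcond prodrXr.
  by congr (_ ^+ _); apply: eq_bigl => i; rewrite eq_sym.
rewrite -!mpolyXD; congr 'X_[_]; apply/mnmP => i; rewrite !mnmDE !mnmE.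
have := moD i; have : (mo i <= absz d)%N by rewrite dE (bigD1 i) //= leq_addr.
lia.
Qed.

Lemma ord_ge_mull f g (p : 'I_k -> R) nu : ord_ge f p nu -> ord_ge (g * f) p nu.
Proof.
move=> /ord_geP lf; apply/ord_geP; rewrite rmorphM /=.
exact: (@lowdegM _ _ 0).
Qed.

Lemma ord_ge_crem f d (p q : 'I_k -> R) nu :
  homog_of_deg d f -> bounded f -> (forall i, p i * q i = 1) ->
  ord_ge f q nu -> ord_ge (crem D f) p nu.
Proof.
move=> hf fD pq fq.
have p0 i : p i != 0.
  by apply/eqP => pi0; have /esym/eqP := pq i; rewrite pi0 mul0r oner_eq0.
suff H : ord_ge ('X_[ [multinom absz d | _ < k] ] * crem D f) p nu.
  by apply: (ord_ge_cancelXm _ H) => i _; apply: p0.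
rewrite (crem_comp hf fD); apply: ord_ge_mull.
have c1 : (\prod_i p i) * (\prod_i q i) = 1 by rewrite -big_split big1 // => i _; apply: pq.
(* The polynomial Cremona map sends p to the coordinatewise inverse q times the product of the p_l,
   which is the same projective point. *)
apply: (ord_ge_comp (p' := fun i => (\prod_l p l) * q i)) => [i|].
  rewrite tnth_mktuple rmorph_prod /= [in RHS](bigD1 i) //= mulrAC pq mul1r.
  by apply: eq_bigr => l _; rewrite mevalXU.
apply: ord_ge_scale hf _ _ fq => //.
by apply/unitrP; exists (\prod_i q i); rewrite mulrC c1.
Qed.

End Crem.

Section Lsp.
Variables (r n : nat) (F : fieldType).
Implicit Types (P Q : nat -> 'cV[F]_r.+1) (L : lat n) (f : {mpoly F[r.+1]}).

(** The configuration is arbitrary because the intermediate ones, such as [gen_pts k P], are not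
    standard. Lattice coordinates are (d, -nu_1, ..., -nu_n), hence the sign. *)
Definition Lsp P L f : Prop :=
  homog_of_deg (L ord0) f /\
  forall j : 'I_n, ord_ge f (fun i => P j i 0) (- L (lift ord0 j)).

Lemma Lsp_eq P Q L f : (forall j : 'I_n, P j = Q j) -> Lsp P L f -> Lsp Q L f.
Proof. by move=> PQ [hf of_]; split=> [//|j]; have := of_ j; rewrite PQ. Qed.

Lemma Lsp_lsub P Q L f (h : 'M[F]_r.+1) (lam : nat -> F) :
  (forall j, (j < n)%N -> lam j != 0) ->
  (forall j, (j < n)%N -> h *m Q j = lam j *: P j) ->
  Lsp P L f -> Lsp Q L (lsub h f).
Proof.
move=> lam0 hQ [hf of_]; split=> [|j]; first exact: lsub_homog.
apply: (ord_ge_comp (p' := fun i => (lam j *: P j) i 0)) => [i|].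
  rewrite tnth_mktuple raddf_sum /= -hQ // mxE.
  by apply: eq_bigr => l _; rewrite mevalZ mevalXU.
apply: (ord_ge_scale (c := lam j)) hf _ _ (of_ j); last by move=> i; rewrite mxE.
by rewrite unitfE lam0.
Qed.

Lemma Lsp_map (E : fieldType) (s : {rmorphism F -> E}) P L f :
  Lsp P L f ->
  homog_of_deg (L ord0) (map_mpoly s f) /\
  forall j : 'I_n, ord_ge (map_mpoly s f) (fun i => s (P j i 0)) (- L (lift ord0 j)).
Proof.
move=> [/homog_of_degP hf of_]; split.
  apply/homog_of_degP => mo; rewrite (perm_mem (msupp_map_mpoly _ (fmorph_inj s))).
  exact: hf.
move=> j mo lt; have E1 := map_mpoly_comp
  [tuple 'X_i + (P j i 0)%:MP | i < r.+1] f (fmorph_inj s).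
transitivity ((map_mpoly s (f \mPo [tuple 'X_i + (P j i 0)%:MP | i < r.+1]))@_mo).
  rewrite E1; congr (_@_mo); apply: eq_comp_mpoly => i; rewrite [RHS]tnth_map !tnth_mktuple.
  by rewrite rmorphD /= map_mpolyX map_mpolyC.
by apply/eqP; rewrite mcoeff_map_mpoly fmorph_eq0; apply/eqP/of_.
Qed.

Hypothesis rn : (r.+1 < n)%N.

Lemma Lsp_perm P L f k : (0 < k < n)%N ->
  Lsp (gen_pts k P) L f -> Lsp P (lat_refl r.+1 k L) f.
Proof.
move=> k0n [hf of_]; have /andP[k0 kn] := k0n; split.
  rewrite (_ : lat_refl r.+1 k L ord0 = L ord0) // (lat_reflSE rn) //; congr (L _).
  by apply: val_inj; rewrite /swapn !ltn_eqF //= inordK.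
move=> j; have jn := ltn_ord j.
(* Point j, counted from 0, carries lattice coordinate j+1: the transposition is [swapn k.-1 k] on
   points and [swapn k k.+1] on coordinates. *)
have sj : (swapn k.-1 k j < n)%N by rewrite /swapn; repeat case: ifP => ?; lia.
have := of_ (Ordinal sj); rewrite /gen_pts gtn_eqF // (lat_reflSE rn) //.
rewrite -[if _ then k else _]/(swapn k.-1 k (swapn k.-1 k j)) swapnK.
rewrite (_ : lift ord0 (Ordinal sj) = inord (swapn k k.+1 (lift ord0 j))) //.
apply: val_inj; rewrite /= /bump /= !add1n inordK.
  by rewrite /swapn; repeat case: ifP => ?; lia.
by rewrite /swapn; repeat case: ifP => ?; lia.
Qed.

(** The exponent of x_i is d minus the multiplicity at the i-th coordinate point, the largest one
    allowed there by [ord_ge_coord_point]. [absz] changes nothing once the space contains a nonzero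
    polynomial. *)
Definition crem_exp L : 'X_{1..r.+1} := [multinom absz (L ord0 + L (inord i.+1))%R | i < r.+1].

Definition coord_points P := forall (l i : 'I_r.+1), P l i 0 = (i == l)%:R.

Lemma Lsp_bound P L f mo (i : 'I_r.+1) : coord_points P ->
  Lsp P L f -> mo \in msupp f -> (mo i)%:Z <= L ord0 + L (inord i.+1).
Proof.
move=> Pe [hf of_] mof.
have ln : (i < n)%N by have := ltn_ord i; lia.
have := of_ (Ordinal ln); rewrite (_ : lift ord0 _ = inord i.+1); last first.
  by apply: val_inj; rewrite /= inordK.
move=> /(ord_ge_coord_point _ hf (Pe i)) /(_ _ mof).
by rewrite opprK.
Qed.

Lemma crem_expE P L f mo (i : 'I_r.+1) : coord_points P ->
  Lsp P L f -> mo \in msupp f -> (crem_exp L i)%:Z = L ord0 + L (inord i.+1).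
Proof.
move=> Pe PL mof; rewrite mnmE; have := Lsp_bound i Pe PL mof.
by move=> le; rewrite gez0_abs //; apply: le_trans le.
Qed.

Lemma crem_exp_bound P L f : coord_points P -> Lsp P L f ->
  {in msupp f, forall mo, (mo <= crem_exp L)%MM}.
Proof.
move=> Pe PL mo mof; apply/mnm_lepP => i.
by have := Lsp_bound i Pe PL mof; rewrite -(crem_expE i Pe PL mof) lez_nat.
Qed.

(** s_0 changes d and the coordinates 1, ..., m by opposite amounts. Thus the same monomial serves
    in both directions and [crem] is its own inverse. *)
Lemma crem_exp_refl L : crem_exp (lat_refl r.+1 0 L) = crem_exp L.
Proof.
apply/mnmP => i; rewrite !mnmE; congr absz; rewrite !(lat_refl0E rn) /=.
rewrite inordK; last by have := ltn_ord i; lia.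
by rewrite /= ltn_ord /=; ring.
Qed.

(** The new degree is the sum of the exponents D_i minus d, which is the e_0-coordinate of s_0.L. At
    a coordinate point the condition is the bound by D_i, which s_0 preserves; at the other points
    [ord_ge_crem] carries the order over. *)
Lemma Lsp_crem P Q L f : coord_points P -> coord_points Q ->
  (forall (j : 'I_n) i, (r < j)%N -> P j i 0 * Q j i 0 = 1) ->
  Lsp Q L f -> Lsp P (lat_refl r.+1 0 L) (crem (crem_exp L) f).
Proof.
move=> Pe Qe PQ QL; have fD := crem_exp_bound Qe QL; have [hf of_] := QL.
have hcf : homog_of_deg (lat_refl r.+1 0 L ord0) (crem (crem_exp L) f).
  apply/homog_of_degP => mo; rewrite msupp_crem // => /andP[moD mof].
  have := mdegD mo (crem_exp L - mo)%MM; rewrite addmC submK // => E.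
  have /homog_of_degP/(_ _ mof) h1 := hf.
  have -> : (mdeg mo)%:Z = (mdeg (crem_exp L))%:Z - L ord0 by rewrite E -h1 PoszD addrK.
  rewrite mdegE (big_morph Posz PoszD (erefl _)) lat_refl0E //=.
  rewrite (eq_bigr _ (fun i _ => crem_expE i Qe QL mof)) big_split sumr_const card_ord /=.
  rewrite -mulr_natl; set S := \sum_(i < r.+1) _; rewrite -[r.+1%:Z]natz; ring.
split=> // j; have [jr|rj] := leqP j r.
  have jr' : (j < r.+1)%N by [].
  apply/(ord_ge_coord_point _ hcf (Pe (Ordinal jr'))) => mo.
  rewrite msupp_crem // => /andP[/mnm_lepP/(_ (Ordinal jr')) le mof].
  apply: (@le_trans _ _ (crem_exp L (Ordinal jr'))%:Z); first by rewrite lez_nat.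
  rewrite (crem_expE _ Qe QL mof) opprK !(lat_refl0E rn) /= /bump /= !add1n jr' /=.
  rewrite (_ : inord j.+1 = lift ord0 j); first by set S := \sum_(i < r.+1) _; lia.
  by apply: val_inj; rewrite /= /bump /= add1n inordK //; have := ltn_ord j; lia.
rewrite (_ : lat_refl _ _ _ _ = L (lift ord0 j)).
  by apply: (ord_ge_crem hf fD) (of_ j) => i; apply: PQ.
by rewrite (lat_refl0E rn) /= /bump /= add1n ltnS leqNgt rj /= subrr mulr0 subr0.
Qed.

End Lsp.

(** * Dimension one *)

Definition dim1 (k : nat) (F : fieldType) (V : {mpoly F[k]} -> Prop) : Prop :=
  exists2 f, V f /\ f != 0 & forall g, V g -> exists c : F, g = c *: f.

(** A semilinear bijection carries a generator to a generator. [s] is the twist of scalars: a field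
    automorphism when coefficients are acted on, the identity otherwise. *)
Lemma dim1_transfer (k : nat) (F E : fieldType) (V : {mpoly F[k]} -> Prop)
    (W : {mpoly E[k]} -> Prop) (s : F -> E) phi psi :
  (forall f, V f -> W (phi f)) -> (forall g, W g -> V (psi g)) ->
  (forall g, W g -> phi (psi g) = g) -> (forall f, V f -> phi f = 0 -> f = 0) ->
  (forall c f, V f -> phi (c *: f) = s c *: phi f) ->
  dim1 V -> dim1 W.
Proof.
move=> VW WV phiK phi0 phiZ [f [Vf f0] Vdim]; exists (phi f).
  by split; [exact: VW | apply: contra_neq f0; exact: phi0].
move=> g Wg; have [c gE] := Vdim _ (WV _ Wg); exists (s c).
by rewrite -phiZ // -gE phiK.
Qed.

Lemma mmap_map_mpoly (k : nat) (R S T : comNzRingType) (s : {rmorphism R -> S})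
    (f : {rmorphism S -> T}) (h : 'I_k -> T) (p : {mpoly R[k]}) :
  mmap f h (map_mpoly s p) = mmap (f \o s) h p.
Proof.
rewrite /map_mpoly rmorph_mmap; apply: eq_mmap => [c|i] /=; first by rewrite mmapC.
by rewrite mmapX mmap1U.
Qed.

Lemma mmap_homog (k : nat) (R : idomainType) (S : fieldType) (s : {rmorphism R -> S})
    (d : int) (f : {mpoly R[k]}) (c : S) (v : 'I_k -> S) :
  homog_of_deg d f -> mmap s (fun i => c * v i) f = c ^ d * mmap s v f.
Proof.
move=> /homog_of_degP hf; rewrite /mmap mulr_sumr; apply: eq_big_seq => mo mof.
rewrite mulrCA; congr (_ * _); rewrite -(hf _ mof) /= /mmap1 mdegE -exprnP expr_sum -big_split.
by apply: eq_bigr => i _; rewrite exprMn.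
Qed.

Lemma cremZ (k : nat) (F : fieldType) (D : 'X_{1..k}) (c : F) (f : {mpoly F[k]}) :
  {in msupp f, forall mo, (mo <= D)%MM} -> crem D (c *: f) = c *: crem D f.
Proof.
move=> fD; apply/mpolyP => mo; rewrite mcoeffZ !mcoeff_crem //.
  by case: ifP => _; rewrite ?mulr0 // mcoeffZ.
by move=> m; rewrite mcoeff_msupp mcoeffZ mulf_eq0 negb_or -mcoeff_msupp => /andP[_ /fD].
Qed.

Lemma gen_ptsK (r k : nat) (F : fieldType) (P : nat -> 'cV[F]_r.+1) :
  gen_pts k (gen_pts k P) =1 P.
Proof.
move=> j; rewrite /gen_pts; case: eqP => _ /=; last by congr (P _); apply: swapnK.
case: ltnP => //= jr; apply/matrixP => i z; rewrite ord1 !mxE.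
exact: invrK.
Qed.

Section Dim.
Variables (r n : nat) (F : fieldType).
Hypothesis rn : (r.+1 < n)%N.
Implicit Types (P Q : nat -> 'cV[F]_r.+1) (L : lat n).

Lemma lsub_eq0 (h : 'M[F]_r.+1) f : h \in unitmx -> lsub h f = 0 -> f = 0.
Proof.
move=> hU f0; rewrite -[f]lsub1 -(mulmxV hU) -lsubM f0.
exact: comp_mpoly0.
Qed.

Lemma dim1_lsub P Q L (h : 'M[F]_r.+1) (lam : nat -> F) :
  h \in unitmx -> (forall j, (j < n)%N -> lam j != 0) ->
  (forall j, (j < n)%N -> h *m Q j = lam j *: P j) ->
  dim1 (Lsp P L) -> dim1 (Lsp Q L).
Proof.
move=> hU lam0 hQ; apply: (dim1_transfer (s := id) (phi := lsub h) (psi := lsub (invmx h))).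
- by move=> f; apply: Lsp_lsub lam0 hQ.
- move=> g; apply: (Lsp_lsub (lam := fun j => (lam j)^-1)) => j jn.
    by rewrite invr_eq0 lam0.
  apply: (canRL (scalerK (lam0 _ jn))).
  by rewrite scalemxAr -hQ // mulKmx.
- by move=> g _; rewrite lsubM mulVmx ?lsub1.
- by move=> f _; apply: lsub_eq0.
- by move=> c f _; apply: lsubZ.
Qed.

Lemma gen_pts_coord_points k P : coord_points P -> k = 0%N -> coord_points (gen_pts k P).
Proof. by move=> Pe -> l i; rewrite /gen_pts /= ltn_ord. Qed.

Lemma dim1_gen_pts P L k : (k < n)%N -> coord_points P ->
  (forall (j : 'I_n) i, (r < j)%N -> P j i 0 != 0) ->
  dim1 (Lsp (gen_pts k P) L) -> dim1 (Lsp P (lat_refl r.+1 k L)).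
Proof.
move=> kn Pe P0; have [k0|k0] := posnP k; last first.
  apply: (dim1_transfer (s := id) (phi := id) (psi := id)) => //.
    by move=> f; apply: Lsp_perm; rewrite ?k0.
  move=> f fL; suff: Lsp (gen_pts k P) (lat_refl r.+1 k (lat_refl r.+1 k L)) f.
    by rewrite lat_refl_invol.
  apply: (Lsp_perm rn); first by rewrite k0 kn.
  by apply: Lsp_eq fL => j; rewrite gen_ptsK.
have Qe := gen_pts_coord_points Pe k0.
have PQ (j : 'I_n) i : (r < j)%N -> P j i 0 * gen_pts k P j i 0 = 1.
  by move=> rj; rewrite /gen_pts k0 /= ltnNge rj /= mxE divff ?P0.
apply: (dim1_transfer (s := id) (phi := crem (crem_exp r L)) (psi := crem (crem_exp r L))).
- by move=> f; rewrite {2}k0; apply: Lsp_crem.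
- move=> g; rewrite -{2}(lat_refl_invol rn L kn) -(crem_exp_refl rn) -{1}k0 {3}k0.
  by apply: Lsp_crem => // j i rj; rewrite mulrC PQ.
- move=> g; rewrite k0 => gL; apply: cremK; rewrite -(crem_exp_refl rn).
  exact: crem_exp_bound gL.
- move=> f fL f0; rewrite -[f](cremK (crem_exp_bound rn Qe fL)) f0.
  by rewrite /crem msupp0 big_nil.
- by move=> c f fL; apply: cremZ; apply: crem_exp_bound fL.
Qed.

Lemma dim1_map P Q L (s : {rmorphism F -> F}) : involutive s ->
  (forall j i, (j < n)%N -> s (P j i 0) = Q j i 0) ->
  dim1 (Lsp P L) -> dim1 (Lsp Q L).
Proof.
move=> sK sP; have mapK : cancel (map_mpoly s) (map_mpoly (n := r.+1) s).
  by move=> f; apply/mpolyP => mo; rewrite !mcoeff_map_mpoly /= sK.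
apply: (dim1_transfer (s := s) (phi := map_mpoly s) (psi := map_mpoly s)).
- move=> f /(Lsp_map s)[hf of_]; split=> [|j]; first exact: hf.
  by apply: ord_ge_eq (of_ j) => i; rewrite sP.
- move=> f /(Lsp_map s)[hf of_]; split=> [|j]; first exact: hf.
  by apply: ord_ge_eq (of_ j) => i; rewrite -sP ?sK.
- by move=> g _; rewrite mapK.
- by move=> f _ f0; rewrite -[f]mapK f0 rmorph0.
- by move=> c f _; rewrite map_mpolyZ.
Qed.

Lemma lat_eE j (i : 'I_n.+1) : lat_e n j i = (i == j :> nat)%:R.
Proof. exact: ffunE. Qed.

Lemma lat_e0 j : (0 < j)%N -> lat_e n j ord0 = 0.
Proof. by move=> j0; rewrite ffunE /= ltn_eqF. Qed.

Lemma Lsp_one P j : (0 < j)%N -> Lsp P (lat_e n j) 1.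
Proof.
move=> j0; split=> [|l mo]; first by rewrite lat_e0 // /homog_of_deg /= dhomog1.
by rewrite ffunE; case: (_ == j).
Qed.

Lemma dim1_e P j : (0 < j)%N -> dim1 (Lsp P (lat_e n j)).
Proof.
move=> j0; exists 1; first by split; [exact: Lsp_one | exact: oner_neq0].
move=> g []; rewrite lat_e0 // => /homog_of_degP hg _; exists g@_0.
rewrite -mul_mpolyC mulr1; apply/mpolyP => mo; rewrite mcoeffC.
have [->|mo0] := eqVneq mo 0%MM; first by rewrite mulr1.
rewrite mulr0; apply: memN_msupp_eq0; apply: contra mo0 => /hg [] /eqP.
by rewrite mdeg_eq0.
Qed.

(** s_0 maps e_i to e_0 minus the other e_l with l <= m: linear forms vanishing at the other
    coordinate points. *)
Lemma Lsp_X P (i : 'I_r.+1) : coord_points P ->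
  Lsp P (lat_refl r.+1 0 (lat_e n i.+1)) 'X_i.
Proof.
move=> Pe; rewrite (lat_refl0_e rn) /= ?ltn_ord //; split=> [|j mo].
  have -> : (lat_e n i.+1 + lat_h r.+1 n 0) ord0 = 1 by rewrite ffunE lat_e0 // lat_h0E.
  by rewrite /homog_of_deg /= dhomogX; apply/eqP/mdeg1.
have -> : (lat_e n i.+1 + lat_h r.+1 n 0) (lift ord0 j) =
    (j == i :> nat)%:R - (j < r.+1)%N%:R.
  transitivity (lat_e n i.+1 (lift ord0 j) + lat_h r.+1 n 0 (lift ord0 j)).
    by rewrite ffunE.
  rewrite (lat_h0E rn).
  exact: (congr2 (fun x y : int => x + y) (lat_eE i.+1 (lift ord0 j)) (sub0r _)).
have [->|ji] := eqVneq (j : nat) i; first by rewrite ltn_ord subrr.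
case: (ltnP j r.+1) => jr; last by rewrite subrr.
rewrite add0r opprK /= ltz_nat ltnS leqn0 mdeg_eq0 => /eqP->.
rewrite mcoeff0_shift mevalXU (Pe (Ordinal jr)) -val_eqE /= eq_sym.
by rewrite (negbTE ji).
Qed.

End Dim.

(** * Evaluation at the generic point *)

Lemma map_frame_mx (r k : nat) (F E : fieldType) (e : {rmorphism F -> E})
    (u : nat -> nat -> F) (u' : nat -> nat -> E) :
  (k = r.+2 -> forall i, (i < r)%N -> e (u i 0%N) = u' i 0%N) ->
  map_mx e (frame_mx r k u) = frame_mx r k u'.
Proof.
move=> eu; rewrite /frame_mx; case: ifP => _; first exact: map_perm_mx.
case: ifP => _.
  by apply/matrixP => i j; rewrite !mxE; case: ifP; rewrite ?rmorphN ?rmorph_nat ?rmorph1.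
case: eqP => [kr|_]; last exact: map_mx1.
rewrite map_diag_mx; congr diag_mx; apply/matrixP => i j; rewrite !mxE.
by case: ifP => jr; rewrite ?rmorph1 ?eu.
Qed.

Lemma stdpts_coord_points (r : nat) (F : fieldType) (u : nat -> nat -> F) :
  coord_points (stdpts r u).
Proof. by move=> l i; rewrite mxE /stdcoord ltn_ord. Qed.

Lemma stdcoord_rmorph (r N : nat) (F E : fieldType) (s : {rmorphism F -> E})
    (u : nat -> nat -> F) (u' : nat -> nat -> E) j i :
  (forall i j, (i < r)%N -> (j < N - r.+2)%N -> s (u i j) = u' i j) ->
  (j < N)%N -> s (stdcoord r u j i) = stdcoord r u' j i.
Proof.
move=> su jN; rewrite /stdcoord; case: ifP => rj; first by rewrite rmorph_nat.
case: (j =P r.+1) => [_|jr]; first by rewrite rmorph1.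
by case: ifP => ir; rewrite ?rmorph1 ?su //; lia.
Qed.

Lemma stdcoord_neq0 (r N : nat) (F : fieldType) (u : nat -> nat -> F) j i :
  (forall i j, (i < r)%N -> (j < N - r.+2)%N -> u i j != 0) ->
  (r < j < N)%N -> stdcoord r u j i != 0.
Proof.
move=> u0 /andP[rj jN]; rewrite /stdcoord ltnNge rj /=.
case: (j =P r.+1) => [_|jr]; first exact: oner_neq0.
by case: ifP => ir; rewrite ?oner_neq0 // u0 //; lia.
Qed.

(** * Passing between the coordinates y and x = y / a *)

Section Rescale.
Variables (r n : nat) (F : fieldType) (a : 'I_r.+1 -> F).
Hypothesis a0 : forall i, a i != 0.
Implicit Types (P : nat -> 'cV[F]_r.+1) (L : lat n).

Definition rescale P (j : nat) : 'cV[F]_r.+1 := \col_i (P j i 0 / a i).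

Let h := diag_mx (\row_i a i).
Let h' := diag_mx (\row_i (a i)^-1).

Let h'h : h' *m h = 1%:M.
Proof.
apply/matrixP => i j; rewrite mul_diag_mx !mxE.
by have [->|_] := eqVneq i j; rewrite ?mulr1n ?mulr0n ?mulr0 // mulVf.
Qed.

Lemma diag_inv_unit : h' \in unitmx.
Proof. by have [] := mulmx1_unit h'h. Qed.

Lemma lsub_rescale P L f : Lsp (rescale P) L f -> Lsp P L (lsub h' f).
Proof.
apply: (Lsp_lsub (lam := fun=> 1)) => j _; first exact: oner_neq0.
by rewrite scale1r; apply/matrixP => i l; rewrite ord1 mul_diag_mx !mxE mulrC.
Qed.

Lemma dim1_rescale P L : dim1 (Lsp P L) -> dim1 (Lsp (rescale P) L).
Proof.
have hU : h \in unitmx by have [] := mulmx1_unit h'h.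
apply: (dim1_lsub (h := h) (lam := fun=> 1) hU) => j _; first exact: oner_neq0.
by rewrite scale1r; apply/matrixP => i l; rewrite ord1 mul_diag_mx !mxE mulrC divfK.
Qed.

Lemma mmap_lsub_diag (E : fieldType) (e : {rmorphism F -> E}) (v : 'I_r.+1 -> E) f :
  mmap e v (lsub h' f) = mmap e (fun i => v i / e (a i)) f.
Proof.
rewrite mmap_lsub; apply: eq_mmap => // i.
rewrite (bigD1 i) //= big1 ?addr0 => [|j ji]; first by rewrite !mxE eqxx fmorphV mulrC.
by rewrite mxE eq_sym (negbTE ji) rmorph0 mul0r.
Qed.

End Rescale.

(** The conclusion is boolean so that [choice_fun] can select the scalars for all i at once. *)
Lemma dim1_proportional (k : nat) (F : fieldType) (V : {mpoly F[k]} -> Prop) f g :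
  dim1 V -> V f -> V g -> f != 0 -> g != 0 -> exists c, (c != 0) && (g == c *: f).
Proof.
move=> [b _ Vdim] /Vdim[c ->] /Vdim[c' ->]; rewrite !scaler_eq0 !negb_or.
move=> /andP[c0 b0] /andP[c'0 _]; exists (c' / c).
by rewrite mulf_neq0 ?invr_eq0 //= scalerA divfK.
Qed.

Lemma choice_fun (I : Type) (T : choiceType) (p : I -> pred T) :
  (forall i, exists x, p i x) -> exists f : I -> T, forall i, p i (f i).
Proof. by move=> ex_p; exists (fun i => xchoose (ex_p i)) => i; apply: xchooseP. Qed.

Lemma divf_neq0 (F : fieldType) (x y : F) : x != 0 -> y != 0 -> x / y != 0.
Proof. by move=> x0 y0; rewrite mulf_neq0 ?invr_eq0. Qed.

Lemma mmap_ratio (k : nat) (F E : fieldType) (e : {rmorphism F -> E}) (v : 'I_k -> E)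
    (f g : {mpoly F[k]}) (c c' : F) (lam t : E) :
  c != 0 -> c' != 0 -> mmap e v f != 0 -> mmap e v g = lam * t * mmap e v f ->
  e (c / c') * mmap e v (c' *: g) / mmap e v (c *: f) = lam * t.
Proof.
move=> c0 c'0 f0 gE; rewrite !mmapZ gE fmorph_div.
have : e c != 0 by rewrite fmorph_eq0.
have : e c' != 0 by rewrite fmorph_eq0.
by move: f0; move: (mmap e v f) (e c) (e c') => x y z x0 z0 y0; field; apply/and3P; split.
Qed.

(** * The effect of one generator on a polynomial and on its value at q *)

Section Step.
Variables (r n k : nat) (F E : fieldType).
Variables (e : {rmorphism F -> E}) (s : {rmorphism F -> F}) (s' : {rmorphism E -> E}).
Variables (u : nat -> nat -> F) (u' : nat -> nat -> E).
Hypotheses (r0 : (0 < r)%N) (rn : (r.+1 < n)%N) (kn : (k < n)%N).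
Hypothesis u_neq0 : forall i j, (i < r)%N -> (j < n - r.+2)%N -> u i j != 0.
Hypothesis u'_neq0 : forall i j, (i < r)%N -> (j < n.+1 - r.+2)%N -> u' i j != 0.
Hypothesis eu : forall i j, (i < r)%N -> (j < n - r.+2)%N -> e (u i j) = u' i j.
Hypothesis sK : involutive s.
Hypothesis su : forall i j, (i < r)%N -> (j < n - r.+2)%N -> s (u i j) = coord_act r k u i j.
Hypothesis s'u' :
  forall i j, (i < r)%N -> (j < n.+1 - r.+2)%N -> s' (u' i j) = coord_act r k u' i j.
Hypothesis es : forall x, e (s x) = s' (e x).
Implicit Types (L : lat n) (f : {mpoly F[r.+1]}).

Local Notation P := (stdpts r u).
Local Notation h := (frame_mx r k u).
Let q (i : 'I_r.+1) : E := stdcoord r u' n i.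

Let hU : h \in unitmx. Proof. exact: frame_mx_unit r0 kn u_neq0. Qed.

Let sP j i : (j < n)%N -> s (P j i 0) = stdpts r (coord_act r k u) j i 0.
Proof. by move=> jn; rewrite !mxE; apply: stdcoord_rmorph su jn. Qed.

Let frameP j : (j < n)%N ->
  invmx h *m gen_pts k P j = frame_scale r k u j *: stdpts r (coord_act r k u) j.
Proof. by move=> jn; rewrite (gen_pts_frame r0 kn u_neq0 rn jn) -scalemxAr mulKmx. Qed.

Let P_neq0 (j : 'I_n) i : (r < j)%N -> P j i 0 != 0.
Proof. by move=> rj; rewrite mxE (stdcoord_neq0 _ u_neq0) // rj ltn_ord. Qed.

Lemma dim1_refl L : dim1 (Lsp P L) -> dim1 (Lsp P (lat_refl r.+1 k L)).
Proof.
move=> dL; apply: (dim1_gen_pts rn kn (stdpts_coord_points u) P_neq0).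
apply: (dim1_lsub (h := invmx h) (lam := frame_scale r k u)
  (P := stdpts r (coord_act r k u))); first by rewrite unitmx_inv.
- exact: frame_scale_neq0 r0 kn u_neq0.
- exact: frameP.
exact: dim1_map sK sP dL.
Qed.

(** Acting on coefficients gives a polynomial for the standard representative of [P].s_k;
    substituting the inverse frame moves the conditions to [gen_pts k P]. *)
Definition step_frame f := lsub (invmx h) (map_mpoly s f).

Definition step L f :=
  if k == 0%N then crem (crem_exp r L) (step_frame f) else step_frame f.

(** Integer powers keep this defined for every lattice element, in particular for w.h_0. *)
Definition step_factor L : E :=
  (if k == 0%N then \prod_i q i ^ (L ord0 + L (inord i.+1)) else 1) *
  frame_scale r k u' n ^ L ord0.

Lemma Lsp_step_frame L f : Lsp P L f -> Lsp (gen_pts k P) L (step_frame f).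
Proof.
move=> /(Lsp_map s)[hf of_]; apply: (Lsp_lsub _ frameP).
  exact: frame_scale_neq0 r0 kn u_neq0.
split=> [|j]; first exact: hf.
by apply: ord_ge_eq (of_ j) => i; rewrite sP.
Qed.

Lemma Lsp_step L f : Lsp P L f -> Lsp P (lat_refl r.+1 k L) (step L f).
Proof.
move=> /Lsp_step_frame; rewrite /step; have [k0|k0] := posnP k; last first.
  by apply: (Lsp_perm rn); rewrite k0.
have Pe : coord_points P := stdpts_coord_points u; have Qe := gen_pts_coord_points Pe k0.
rewrite {2}k0; apply: Lsp_crem => // j i rj.
by rewrite /gen_pts k0 /= ltnNge rj /= mxE divff ?P_neq0.
Qed.

Lemma step_eq0 L f : Lsp P L f -> step L f = 0 -> f = 0.
Proof.
move=> fL f0; suff : step_frame f = 0.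
  move=> /(lsub_eq0 (h := invmx h)); rewrite unitmx_inv => /(_ hU) sf0.
  apply/mpolyP => mo; apply: (fmorph_inj s).
  by rewrite -mcoeff_map_mpoly sf0 !raddf0.
have gL := Lsp_step_frame fL; move: f0; rewrite /step; have [k0 f0|//] := eqVneq k 0%N.
have Qe : coord_points (gen_pts k P).
  exact: gen_pts_coord_points (stdpts_coord_points u) k0.
by rewrite -[step_frame f](cremK (crem_exp_bound rn Qe gL)) f0 /crem msupp0 big_nil.
Qed.

Lemma frame_scale_last_neq0 : frame_scale r k u' n != 0.
Proof. exact: (frame_scale_neq0 r0 (ltnW kn : (k < n.+1)%N) u'_neq0). Qed.

Lemma q_neq0 i : q i != 0.
Proof. by apply: (stdcoord_neq0 _ u'_neq0); rewrite (ltnW rn) /=. Qed.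

(** s'(f(q)) is the polynomial with transformed coefficients at s'(q), and the inverse frame takes
    the moved q to [frame_scale] times s'(q); homogeneity extracts the power. *)
Lemma step_frame_eval L f : homog_of_deg (L ord0) f ->
  mmap e (fun i => gen_pts k (stdpts r u') n i 0) (step_frame f) =
  frame_scale r k u' n ^ L ord0 * s' (mmap e q f).
Proof.
move=> hf; rewrite mmap_lsub mmap_map_mpoly rmorph_mmap -(mmap_homog _ _ _ hf).
apply: eq_mmap => [x|i] /=; first exact: es.
have hE : map_mx e h = frame_mx r k u'.
  by apply: map_frame_mx => kr l lr; apply: eu => //; lia.
transitivity ((map_mx e (invmx h) *m gen_pts k (stdpts r u') n) i 0).
  by rewrite mxE; apply: eq_bigr => j _; rewrite mxE.
rewrite map_invmx hE (gen_pts_frame r0 (ltnW kn : (k < n.+1)%N) u'_neq0 (ltnW rn) (ltnSn n)).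
rewrite -scalemxAr mulKmx; last exact: (frame_mx_unit r0 (ltnW kn : (k < n.+1)%N) u'_neq0).
by rewrite !mxE (stdcoord_rmorph _ s'u').
Qed.

Lemma step_eval L f : Lsp P L f ->
  mmap e q (step L f) = step_factor L * s' (mmap e q f).
Proof.
move=> fL; have [hf _] := fL; have gL := Lsp_step_frame fL.
rewrite /step_factor -mulrA -step_frame_eval // /step.
have [k0|k0] := eqVneq k 0%N; last first.
  rewrite mul1r; apply: eq_mmap => // i.
  rewrite /gen_pts (negbTE k0) ifF ?ifF ?mxE //; lia.
have Qe : coord_points (gen_pts k P).
  exact: gen_pts_coord_points (stdpts_coord_points u) k0.
have gD := crem_exp_bound rn Qe gL.
(* The natural exponents of [crem_exp] are known to equal the integer ones only when there is a
   monomial; for the zero polynomial both sides vanish. *)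
rewrite (mmap_crem _ gD q_neq0); have [->|g0] := eqVneq (step_frame f) 0.
  by rewrite !raddf0 !mulr0.
have [mo mof] : exists mo, mo \in msupp (step_frame f).
  by move: g0; rewrite -msupp_eq0; case: (msupp _) => // mo ? _; exists mo; rewrite mem_head.
congr (_ * _).
  by apply: eq_bigr => i _; rewrite -(crem_expE rn i Qe gL mof).
apply: eq_mmap => // i.
by rewrite /gen_pts k0 /= ltnNge (ltnW rn) /= !mxE.
Qed.

Lemma step_factor_neq0 L : step_factor L != 0.
Proof.
rewrite mulf_neq0 ?expfz_neq0 ?frame_scale_last_neq0 //; case: ifP => _; last exact: oner_neq0.
by apply/prodf_neq0 => i _; rewrite expfz_neq0 ?q_neq0.
Qed.

Lemma step_factorD L L' : step_factor (L + L') = step_factor L * step_factor L'.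
Proof.
rewrite /step_factor [in RHS]mulrACA; congr (_ * _); last first.
  by rewrite ffunE expfzDr ?frame_scale_last_neq0.
case: ifP => _; last by rewrite mulr1.
rewrite -big_split; apply: eq_bigr => i _ /=.
rewrite -expfzDr ?q_neq0 //; congr (_ ^ _).
by rewrite !ffunE addrACA.
Qed.

(** By [step_factorD] the factor of L is common to both values, so the ratio acquires
    [step_factor d], independent of L. *)
Lemma step_ratio L d f g lam t : Lsp P L f -> Lsp P (L + d) g ->
  mmap e q f != 0 -> mmap e q g = lam * t * mmap e q f ->
  mmap e q (step L f) != 0 /\
  mmap e q (step (L + d) g) = step_factor d * s' lam * s' t * mmap e q (step L f).
Proof.
move=> fL gL f0 fg; rewrite (step_eval fL) (step_eval gL).
split; first by rewrite mulf_neq0 ?fmorph_eq0 ?step_factor_neq0.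
by rewrite step_factorD fg !rmorphM; ring.
Qed.

End Step.

(** * Action of words *)

Section Words.
Variables (r n : nat).
Hypotheses (r0 : (0 < r)%N) (rn : (r.+1 < n)%N).
Local Notation K := (cfield r.+1 n).
Local Notation K' := (cfield r.+1 n.+1).
Local Notation cv := (coordvar r.+1 n).
Local Notation cv' := (coordvar r.+1 n.+1).
Local Notation P := (stdpts r cv).

Lemma dim1_act w (L : lat n) : is_word n w -> dim1 (Lsp P L) ->
  dim1 (Lsp P (lat_act r.+1 w L)).
Proof.
move=> + dL; elim: w => [|k w IHw] /= => [_|/andP[kn /IHw dwL]]; first exact: dL.
have [s [_ sK _ scv]] := gen_act_rmorphism r0 rn kn.
exact: (dim1_refl r0 rn kn (coordvar_neq0 r0 (N := n)) sK scv dwL).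
Qed.

Lemma dim1_in_M (L : lat n) : in_M r.+1 L -> dim1 (Lsp P L).
Proof.
move=> [w [wn [j [/andP[j0 _] ->]]]]; apply: dim1_act => //.
exact: dim1_e.
Qed.

Definition zcoord (i : nat) : K' := if (i < r)%N then zvar r.+1 n i else 1.

Lemma zcoordE i : zcoord i = stdcoord r cv' n i.
Proof.
by rewrite /zcoord /stdcoord /zvar -subnS (leq_gtF (ltnW rn)) gtn_eqF.
Qed.

Variable e : {rmorphism K -> K'}.
Hypothesis eE : @embK r.+1 n =1 e.
Hypothesis ecv : forall i j, (i < r)%N -> (j < n - r.+2)%N -> e (cv i j) = cv' i j.
Local Notation ev := (mmap e (fun i : 'I_r.+1 => stdcoord r cv' n i)).

(** One family of polynomials is built along w with a [lam] independent of i. Non-vanishing at q is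
    part of the induction, so that the quotient has a meaning. *)
Lemma word_formula w : is_word n w ->
  exists FG : ('I_r.+1 -> {mpoly K[r.+1]}) * ('I_r.+1 -> {mpoly K[r.+1]}),
  exists2 lam : K', lam != 0 & forall i : 'I_r.+1,
    [/\ Lsp P (lat_act r.+1 w (lat_e n i.+1)) (FG.1 i), FG.1 i != 0,
        Lsp P (lat_act r.+1 w (lat_refl r.+1 0 (lat_e n i.+1))) (FG.2 i), FG.2 i != 0
      & ev (FG.1 i) != 0 /\
        ev (FG.2 i) = lam * (if (i < r)%N then word_act w (zvar r.+1 n i) else 1)
                      * ev (FG.1 i)].
Proof.
elim: w => [_|k w IHw /= /andP[kn /IHw [[F G] /= [lam lam0 FG]]]].
  (* For w = 1 the polynomial x_i takes at q the value z_i, and 1 for the last index by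
     normalization. *)
  exists (fun=> 1, fun i => 'X_i); exists 1; first exact: oner_neq0.
  move=> i /=; split; rewrite ?oner_neq0 //.
  - exact: Lsp_one.
  - exact: (Lsp_X rn i (stdpts_coord_points cv)).
  - by rewrite -msupp_eq0 msuppX.
  - by rewrite rmorph1 oner_neq0 mmapX mmap1U mul1r mulr1 -zcoordE.
have [s [sE sK _ scv]] := gen_act_rmorphism r0 rn kn.
have [s' [s'E _ _ s'cv]] := gen_act_rmorphism (N := n.+1) r0 (ltnW rn) (ltnW kn).
have es x : e (s x) = s' (e x) by rewrite -sE -!eE -s'E gen_act_embK.
have u0 := coordvar_neq0 r0 (N := n); have u'0 := coordvar_neq0 r0 (N := n.+1).
pose st := step k s cv (r := r) (n := n).
pose mu := step_factor r k cv' (n := n).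
(* This is w.h_0, the difference of the two lattice elements for every i; its factor becomes part of
   the new [lam]. *)
pose d := lat_act r.+1 w (lat_h r.+1 n 0).
exists (fun i : 'I_r.+1 => st (lat_act r.+1 w (lat_e n i.+1)) (F i),
  fun i : 'I_r.+1 => st (lat_act r.+1 w (lat_refl r.+1 0 (lat_e n i.+1))) (G i)).
exists (mu d * s' lam).
  apply: mulf_neq0; first exact: (step_factor_neq0 r0 rn kn u'0).
  by rewrite fmorph_eq0.
move=> i /=; have [Fi Fi0 Gi Gi0 [evF evG]] := FG i.
have GL : lat_act r.+1 w (lat_refl r.+1 0 (lat_e n i.+1)) = lat_act r.+1 w (lat_e n i.+1) + d.
  by rewrite lat_refl0_e ?ltn_ord // lat_actD.
rewrite GL in Gi *; split.
- exact: (Lsp_step r0 rn kn u0 scv Fi).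
- by apply: contra_neq Fi0 => /(step_eq0 r0 rn kn u0 scv Fi).
- exact: (Lsp_step r0 rn kn u0 scv Gi).
- by apply: contra_neq Gi0 => /(step_eq0 r0 rn kn u0 scv Gi).
have [evF' evG'] := step_ratio r0 rn kn u0 u'0 ecv scv s'cv es Fi Gi evF evG.
split; first exact: evF'.
have tE : s' (if (i < r)%N then word_act w (zvar r.+1 n i) else 1) =
    if (i < r)%N then gen_act k (word_act w (zvar r.+1 n i)) else 1.
  by case: ifP => _; [rewrite -s'E | exact: rmorph1].
by rewrite tE in evG'.
Qed.

End Words.

(** * The statement in the coordinates x *)

Lemma inL_Lsp (r n : nat) (a : 'I_r.+1 -> cfield r.+1 n) (L : lat n) f :
  inL a L f <-> Lsp (rescale a (stdpts r (coordvar r.+1 n))) L f.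
Proof.
by split=> -[hf of_]; split=> [|j]; try exact: hf; apply: ord_ge_eq (of_ j) => i;
  rewrite /xpt !mxE.
Qed.

Lemma at_q_lsub (r n : nat) (a : 'I_r.+1 -> cfield r.+1 n)
    (e : {rmorphism cfield r.+1 n -> cfield r.+1 n.+1}) f :
  (r.+1 < n)%N -> @embK r.+1 n =1 e ->
  at_q a f = mmap e (fun i : 'I_r.+1 => stdcoord r (coordvar r.+1 n.+1) n i)
    (lsub (diag_mx (\row_i (a i)^-1)) f).
Proof.
move=> rn eE; rewrite mmap_lsub_diag; apply: eq_mmap; first exact: eE.
by move=> i; rewrite -zcoordE // eE.
Qed.

Theorem theorem1 (m n : nat) (hm : (1 < m)%N) (hmn : (m < n)%N)
    (a : 'I_m -> cfield m n) (ha : forall i, a i != 0) :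
  (* (1) *)
  (forall L : lat n, @in_M m n L -> dimL_eq1 a L) /\
  (* (2) *)
  (forall (w : seq nat), is_word n w ->
   forall (F G : 'I_m -> {mpoly (cfield m n)[m]}),
     (forall i : 'I_m, F i != 0 /\ inL a (@lat_act m n w (lat_e n i.+1)) (F i)) ->
     (forall i : 'I_m, G i != 0 /\ inL a (@lat_act m n (rcons w 0%N) (lat_e n i.+1)) (G i)) ->
     exists c : 'I_m -> cfield m n, (forall i, c i != 0) /\
       exists2 lam : cfield m n.+1, lam != 0 &
         forall i : 'I_m,
           embK (c i) * at_q a (G i) / at_q a (F i) =
           lam * (if (i < m.-1)%N then @word_act m n.+1 w (zvar m n i) else 1)).
Proof.
case: m hm hmn a ha => // r r0 rn a a0.
have dimM (L : lat n) : in_M r.+1 L -> dim1 (Lsp (stdpts r (coordvar r.+1 n)) L).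
  exact: dim1_in_M.
split=> [L /dimM /(dim1_rescale a0) [f [fL f0] fdim]|w wn F G hF hG].
  exists f; first by split; [apply/inL_Lsp | exact: f0].
  by move=> g /inL_Lsp/fdim.
have [e [eE _ ecv]] := embK_rmorphism n (r0 : (0 < r)%N).
have [[F0 G0] /= [lam lam0 FG]] := word_formula r0 rn eE ecv wn.
have w0n : is_word n (rcons w 0)
  by rewrite /is_word all_rcons -[all _ w]/(is_word n w) wn andbT; lia.
(* By dimension one any given nonzero polynomial, rewritten in the coordinates y, is a nonzero
   multiple of the constructed one. *)
have mult (w' : seq nat) (i : 'I_r.+1) (f0 f : {mpoly (cfield r.+1 n)[r.+1]}) : is_word n w' ->
    Lsp (stdpts r (coordvar r.+1 n)) (lat_act r.+1 w' (lat_e n i.+1)) f0 -> f0 != 0 ->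
    f != 0 /\ inL a (lat_act r.+1 w' (lat_e n i.+1)) f ->
    exists c, (c != 0) && (lsub (diag_mx (\row_i (a i)^-1)) f == c *: f0).
  move=> w'n f0L f00 [fn0 /inL_Lsp fL].
  have gL := lsub_rescale fL.
  have g0 : lsub (diag_mx (\row_i (a i)^-1)) f != 0.
    by apply: contra_neq fn0; apply: lsub_eq0; apply: diag_inv_unit.
  have w'M : in_M r.+1 (lat_act r.+1 w' (lat_e n i.+1)).
    exists w'; split=> //; exists i.+1; split=> //=.
    by have := ltn_ord i; lia.
  exact: (dim1_proportional (dimM _ w'M) f0L gL f00 g0).
have [cF cFE] : exists c, forall i, (c i != 0) &&
    (lsub (diag_mx (\row_i (a i)^-1)) (F i) == c i *: F0 i).
  apply: (choice_fun (p := fun i c => (c != 0) && (_ == c *: F0 i))) => i; have [FL Fn0 _ _ _] := FG i.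
  exact: (mult w i _ _ wn FL Fn0 (hF i)).
have [cG cGE] : exists c, forall i, (c i != 0) &&
    (lsub (diag_mx (\row_i (a i)^-1)) (G i) == c i *: G0 i).
  apply: (choice_fun (p := fun i c => (c != 0) && (_ == c *: G0 i))) => i; have [_ _ GL Gn0 _] := FG i.
  apply: (mult _ i _ _ w0n _ Gn0 (hG i)).
  by rewrite /lat_act foldr_rcons.
(* Since F_i is [cF i] times and G_i is [cG i] times the constructed polynomial, this quotient turns
   G_i / F_i into the constructed ratio. *)
exists (fun i => cF i / cG i); split.
  by move=> i; have /andP[F1 _] := cFE i; have /andP[G1 _] := cGE i; exact: divf_neq0 F1 G1.
exists lam; first exact: lam0.
move=> i; have [_ _ _ _ [evF evG]] := FG i.
have /andP[F1 /eqP FE] := cFE i; have /andP[G1 /eqP GE] := cGE i.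
rewrite (at_q_lsub _ _ rn eE) (at_q_lsub _ _ rn eE) FE GE eE.
exact: (mmap_ratio F1 G1 evF evG).
Qed.
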